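(* Let $k$ be an algebraically closed field and let $\mathcal{C}$ be a pivotal finite tensor category over $k$. Then a non-zero right modified trace on $\mathrm{Proj}(\mathcal{C})$ exists if and only if $\mathcal{C}$ is unimodular. Furthermore, such a trace is unique up to scalar multiple if it exists.
   Context: A finite abelian category is a $k$-linear category equivalent to the category of finite-dimensional left modules over a finite-dimensional $k$-algebra. A finite tensor category is a finite abelian category $\mathcal{C}$ that is a rigid monoidal category (assumed strict, with strict duality functors) with $k$-bilinear tensor product and simple unit object $\mathbb{1}$. $\mathrm{Proj}(\mathcal{C})$ is the full subcategory of projective objects. $X^*$ is the left dual of $X$, with $\mathrm{ev}_X:X^*\otimes X\to\mathbb{1}$ and $\mathrm{coev}_X:\mathbb{1}\to X\otimes X^*$. A pivotal structure is an isomorphism $\mathfrak{p}:\mathrm{id}_{\mathcal{C}}\to(-)^{**}$ of monoidal functors; a pivotal finite tensor category is one equipped with a pivotal structure. A right modified trace on $\mathrm{Proj}(\mathcal{C})$ is a family of $k$-linear maps $\mathtt{t}_P:\mathrm{Hom}_{\mathcal{C}}(P,P)\to k$ ($P\in\mathrm{Proj}(\mathcal{C})$) such that (i) $\mathtt{t}_P(g\circ f)=\mathtt{t}_Q(f\circ g)$ for all $f:P\to Q$, $g:Q\to P$ with $P,Q$ projective, and (ii) $\mathtt{t}_P\big((\mathrm{id}_P\otimes\mathrm{ev}_{X^*})(f\otimes\mathrm{id}_{X^*})(\mathrm{id}_P\otimes\mathrm{coev}_X)\big)=\mathtt{t}_{P\otimes X}\big((\mathrm{id}_P\otimes\mathfrak{p}_X^{-1})\circ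 f\big)$ for all $P\in\mathrm{Proj}(\mathcal{C})$, $X\in\mathcal{C}$ and $f:P\otimes X\to P\otimes X^{**}$. For a finite-dimensional vector space $V$ and $M\in\mathcal{C}$, $V\cdot M$ is the object with $\mathrm{Hom}_{\mathcal{C}}(V\cdot M,N)\cong\mathrm{Hom}_k(V,\mathrm{Hom}_{\mathcal{C}}(M,N))$ naturally. The Nakayama functor is $\mathbb{N}_{\mathcal{C}}(M)=\int^{X\in\mathcal{C}}\mathrm{Hom}_{\mathcal{C}}(M,X)^*\cdot X$. Put $\alpha_{\mathcal{C}}=\mathbb{N}_{\mathcal{C}}(\mathbb{1})$ (this is the dual of the distinguished invertible object of Etingof–Nikshych–Ostrik). $\mathcal{C}$ is unimodular if $\alpha_{\mathcal{C}}\cong\mathbb{1}$. *)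

(* Defs.v *)
From HB Require Import structures.
From mathcomp Require Import all_boot all_order all_algebra all_field.

Set Implicit Arguments.
Unset Strict Implicit.
Unset Printing Implicit Defensive.

Import GRing.Theory.
Local Open Scope ring_scope.

Declare Scope cat_scope.
Delimit Scope cat_scope with cat.
Local Open Scope cat_scope.

Definition lin_of (k : fieldType) (U V : vectType k) (f : U -> V)
    (lf : linear f) : 'Hom(U, V) :=
  linfun (HB.pack f (GRing.isLinear.Build _ _ _ _ f lf) : {linear U -> V}).

Lemma lin_ofE (k : fieldType) (U V : vectType k) (f : U -> V)
  (lf : linear f) x : lin_of lf x = f x.
Proof. by rewrite lfunE. Qed.

Definition dualv (k : fieldType) (V : vectType k) : vectType k := 'Hom(V, k^o).

(* Hom spaces are finite-dimensional: this is automatic for a finite abelian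
   category, and the categories of modules below satisfy it. *)
Record klincat (k : fieldType) := KLinCat {
  ob :> Type;
  mor : ob -> ob -> vectType k;
  idm : forall X, mor X X;
  compm : forall X Y Z, mor Y Z -> mor X Y -> mor X Z;
  comp1m : forall X Y (f : mor X Y), compm (idm Y) f = f;
  compm1 : forall X Y (f : mor X Y), compm f (idm X) = f;
  compA : forall X Y Z W (h : mor Z W) (g : mor Y Z) (f : mor X Y),
    compm h (compm g f) = compm (compm h g) f;
  comp_linl : forall X Y Z (f : mor X Y), linear (fun g : mor Y Z => compm g f);
  comp_linr : forall X Y Z (g : mor Y Z), linear (fun f : mor X Y => compm g f)
}.
Arguments mor {k k0} X Y : rename.
Arguments idm {k k0} X : rename.
Arguments compm {k k0 X Y Z} g f : rename.

Notation "g ∘ f" := (compm g f) (at level 50, left associativity) : cat_scope.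

Section Basic.
Variables (k : fieldType) (C : klincat k).
Implicit Types X Y P : C.

Definition is_iso X Y (f : mor X Y) : Prop :=
  exists g : mor Y X, g ∘ f = idm X /\ f ∘ g = idm Y.

Definition isomorphic X Y : Prop := exists f : mor X Y, is_iso f.

Definition mono X Y (f : mor X Y) : Prop :=
  forall Z (g h : mor Z X), f ∘ g = f ∘ h -> g = h.

Definition epi X Y (f : mor X Y) : Prop :=
  forall Z (g h : mor Y Z), g ∘ f = h ∘ f -> g = h.

Definition projective P : Prop :=
  forall X Y (e : mor X Y) (f : mor P Y),
    epi e -> exists g : mor P X, e ∘ g = f.

Definition simple_obj X : Prop :=
  idm X <> 0 /\ forall S (i : mor S X), mono i -> i = 0 \/ is_iso i.

(* The identity X -> Y when the objects X and Y are equal; it lets equations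
   between morphisms be stated in a strict monoidal category, where for instance
   (X ⊗ Y) ⊗ Z and X ⊗ (Y ⊗ Z) are equal but not convertible objects. *)
Definition eqm X Y (e : X = Y) : mor X Y :=
  match e in _ = Z return mor X Z with erefl => idm X end.

Definition postcomp M X Y (f : mor X Y) : 'Hom(mor M X, mor M Y) :=
  lin_of (comp_linr f).

Lemma dual_postcomp_linear M X Y (f : mor X Y) :
  linear (fun xi : dualv (mor M Y) => (xi \o postcomp M f)%VF : dualv (mor M X)).
Proof. by move=> a u v; rewrite comp_lfunDl -comp_lfunZl. Qed.

(* Hom(M, f)^* : Hom(M, Y)^* -> Hom(M, X)^* for f : X -> Y. *)
Definition dual_postcomp M X Y (f : mor X Y) :
    'Hom(dualv (mor M Y), dualv (mor M X)) :=
  lin_of (dual_postcomp_linear (M := M) f).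

Lemma postcompE M X Y (f : mor X Y) (g : mor M X) : postcomp M f g = f ∘ g.
Proof. exact: lin_ofE. Qed.

Lemma dual_postcompE M X Y (f : mor X Y) (xi : dualv (mor M Y)) (g : mor M X) :
  (dual_postcomp M f xi : dualv (mor M X)) g = xi (f ∘ g).
Proof.
by rewrite (lin_ofE (dual_postcomp_linear (M := M) f)) comp_lfunE postcompE.
Qed.

End Basic.

Section Equivalence.
Variable k : fieldType.

Record klfunctor (C D : klincat k) := KLFunctor {
  fob :> C -> D;
  fmap : forall X Y : C, 'Hom(mor X Y, mor (fob X) (fob Y));
  fmap1 : forall X : C, fmap X X (idm X) = idm (fob X);
  fmapM : forall (X Y Z : C) (g : mor Y Z) (f : mor X Y),
    fmap X Z (g ∘ f) = fmap Y Z g ∘ fmap X Y f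
}.

Definition equivalent (C D : klincat k) : Prop :=
  exists (F : klfunctor C D) (G : klfunctor D C)
         (eta : forall X : C, mor X (G (F X)))
         (eps : forall Y : D, mor (F (G Y)) Y),
    [/\ forall X, is_iso (eta X),
        forall Y, is_iso (eps Y),
        forall (X X' : C) (f : mor X X'),
          eta X' ∘ f = fmap G _ _ (fmap F _ _ f) ∘ eta X
      & forall (Y Y' : D) (g : mor Y Y'),
          g ∘ eps Y = eps Y' ∘ fmap F _ _ (fmap G _ _ g)].

End Equivalence.

Section Modules.
Variables (k : fieldType) (A : falgType k).

Record fdmod := FdMod {
  fdmod_vect :> vectType k;
  mact : 'Hom(A, 'End(fdmod_vect));
  act1 : mact 1 = \1%VF;
  actM : forall a b, mact (a * b) = (mact a \o mact b)%VF
}.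

Lemma equivariance_defect_linear_in_A (M N : fdmod) (f : 'Hom(M, N)) :
  linear (fun a : A => ((f \o mact M a) - (mact N a \o f))%VF).
Proof.
move=> c a b; rewrite !linearP /= comp_lfunDr -comp_lfunZr comp_lfunDl -comp_lfunZl.
by rewrite opprD addrACA scalerBr.
Qed.

Definition equivariance_defect (M N : fdmod) (f : 'Hom(M, N)) :
    'Hom(A, 'Hom(M, N)) := lin_of (equivariance_defect_linear_in_A f).

Lemma equivariance_defect_linear (M N : fdmod) :
  linear (@equivariance_defect M N).
Proof.
move=> c f g; apply/lfunP => a; rewrite add_lfunE scale_lfunE !lin_ofE.
rewrite comp_lfunDl -comp_lfunZl comp_lfunDr -comp_lfunZr.
by rewrite opprD addrACA scalerBr.
Qed.

Definition modhom (M N : fdmod) : {vspace 'Hom(M, N)} :=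
  lker (lin_of (@equivariance_defect_linear M N)).

Lemma modhomP (M N : fdmod) (f : 'Hom(M, N)) :
  reflect (forall a m, f (mact M a m) = mact N a (f m)) (f \in modhom M N).
Proof.
apply: (iffP idP); rewrite memv_ker lin_ofE.
  move=> /eqP/lfunP f0 a m; move: (f0 a); rewrite lin_ofE zero_lfunE.
  move=> /lfunP/(_ m); rewrite add_lfunE opp_lfunE !comp_lfunE zero_lfunE.
  by move/eqP; rewrite subr_eq0 => /eqP.
move=> fA; apply/eqP/lfunP => a; rewrite lin_ofE zero_lfunE.
by apply/lfunP => m; rewrite add_lfunE opp_lfunE !comp_lfunE fA subrr zero_lfunE.
Qed.

Lemma modid_subproof (M : fdmod) : \1%VF \in modhom M M.
Proof. by apply/modhomP => a m; rewrite !id_lfunE. Qed.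

Lemma modcomp_subproof (M N Q : fdmod)
    (g : subvs_of (modhom N Q)) (f : subvs_of (modhom M N)) :
  (vsval g \o vsval f)%VF \in modhom M Q.
Proof.
apply/modhomP => a m; rewrite !comp_lfunE.
by rewrite (modhomP _ (subvsP f)) (modhomP _ (subvsP g)).
Qed.

Definition modid (M : fdmod) : subvs_of (modhom M M) :=
  Subvs (modid_subproof M).

Definition modcomp (M N Q : fdmod)
    (g : subvs_of (modhom N Q)) (f : subvs_of (modhom M N)) :
    subvs_of (modhom M Q) := Subvs (modcomp_subproof g f).

Program Definition modcat : klincat k :=
  @KLinCat k fdmod (fun M N => subvs_of (modhom M N)) modid modcomp _ _ _ _ _.
Next Obligation. by move=> M N f; apply: val_inj; rewrite /= comp_lfun1l. Qed.
Next Obligation. by move=> M N f; apply: val_inj; rewrite /= comp_lfun1r. Qed.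
Next Obligation.
by move=> M N Q R h g f; apply: val_inj; rewrite /= comp_lfunA.
Qed.
Next Obligation.
move=> M N Q f c g g'; apply: val_inj; rewrite /=.
by rewrite comp_lfunDl -comp_lfunZl.
Qed.
Next Obligation.
move=> M N Q g c f f'; apply: val_inj; rewrite /=.
by rewrite comp_lfunDr -comp_lfunZr.
Qed.

End Modules.

(* A falgType is nonzero; this only excludes the zero category, which has no
   simple object. *)
Definition finite_abelian (k : fieldType) (C : klincat k) : Prop :=
  exists A : falgType k, equivalent C (modcat A).

Record monCat (k : fieldType) := MonCat {
  mon_cat :> klincat k;
  tens : mon_cat -> mon_cat -> mon_cat;
  tunit : mon_cat;
  tensm : forall X X' Y Y' : mon_cat,
    mor X X' -> mor Y Y' -> mor (tens X Y) (tens X' Y');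
  tensm_linl : forall (X X' Y Y' : mon_cat) (g : mor Y Y'),
    linear (fun f : mor X X' => tensm f g);
  tensm_linr : forall (X X' Y Y' : mon_cat) (f : mor X X'),
    linear (fun g : mor Y Y' => tensm f g);
  tensm1 : forall X Y : mon_cat, tensm (idm X) (idm Y) = idm (tens X Y);
  tensmM : forall (X X' X'' Y Y' Y'' : mon_cat)
    (f' : mor X' X'') (f : mor X X') (g' : mor Y' Y'') (g : mor Y Y'),
    tensm (f' ∘ f) (g' ∘ g) = tensm f' g' ∘ tensm f g;
  tensA : forall X Y Z : mon_cat, tens X (tens Y Z) = tens (tens X Y) Z;
  tens1l : forall X : mon_cat, tens tunit X = X;
  tens1r : forall X : mon_cat, tens X tunit = X;
  tensmA : forall (X X' Y Y' Z Z' : mon_cat)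
    (f : mor X X') (g : mor Y Y') (h : mor Z Z'),
    eqm (tensA X' Y' Z') ∘ tensm f (tensm g h)
    = tensm (tensm f g) h ∘ eqm (tensA X Y Z);
  tensm1l : forall (X X' : mon_cat) (f : mor X X'),
    eqm (tens1l X') ∘ tensm (idm tunit) f = f ∘ eqm (tens1l X);
  tensm1r : forall (X X' : mon_cat) (f : mor X X'),
    eqm (tens1r X') ∘ tensm f (idm tunit) = f ∘ eqm (tens1r X)
}.
Arguments tens {k m} X Y : rename.
Arguments tunit {k} m : rename.
Arguments tensm {k m X X' Y Y'} f g : rename.
Arguments tensA {k m} X Y Z : rename.
Arguments tens1l {k m} X : rename.
Arguments tens1r {k m} X : rename.

Notation "X ⊗ Y" := (tens X Y) (at level 40, left associativity) : cat_scope.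
(* The tensor product of morphisms. *)
Notation "f ⊠ g" := (tensm f g) (at level 40, left associativity) : cat_scope.

Section Duality.
Variables (k : fieldType) (C : monCat k).
Implicit Types X Y L : C.

Definition assoc X Y Z : mor (X ⊗ (Y ⊗ Z)) ((X ⊗ Y) ⊗ Z) := eqm (tensA X Y Z).
Definition assocV X Y Z : mor ((X ⊗ Y) ⊗ Z) (X ⊗ (Y ⊗ Z)) :=
  eqm (esym (tensA X Y Z)).
Definition unitl X : mor (tunit C ⊗ X) X := eqm (tens1l X).
Definition unitlV X : mor X (tunit C ⊗ X) := eqm (esym (tens1l X)).
Definition unitr X : mor (X ⊗ tunit C) X := eqm (tens1r X).
Definition unitrV X : mor X (X ⊗ tunit C) := eqm (esym (tens1r X)).

(* L is a left dual of X; equivalently, X is a right dual of L. *)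
Record dual_pair L X := DualPair {
  ev : mor (L ⊗ X) (tunit C);
  coev : mor (tunit C) (X ⊗ L);
  zigzag_obj :
    unitr X ∘ (idm X ⊠ ev) ∘ assocV X L X ∘ (coev ⊠ idm X) ∘ unitlV X = idm X;
  zigzag_dual :
    unitl L ∘ (ev ⊠ idm L) ∘ assoc L X L ∘ (idm L ⊠ coev) ∘ unitrV L = idm L
}.

(* (L' ⊗ L) ⊗ (X ⊗ Y) -> L' ⊗ Y -> 1, the evaluation of L' ⊗ L as the left dual
   of X ⊗ Y. *)
Definition tens_ev L X L' Y (d : dual_pair L X) (d' : dual_pair L' Y) :
    mor ((L' ⊗ L) ⊗ (X ⊗ Y)) (tunit C) :=
  ev d' ∘ ((unitr L' ∘ (idm L' ⊠ ev d) ∘ assocV L' L X) ⊠ idm Y)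
  ∘ assoc (L' ⊗ L) X Y.

End Duality.

(* Both duality functors are strict, i.e. their canonical monoidal structures
   (X ⊗ Y)^* ≅ Y^* ⊗ X^*, 1^* ≅ 1, and likewise for right duals, are identities.
   A map into a left or right dual is determined by its composite with the
   evaluation, so it is enough to compare evaluations. *)
Record rigidCat (k : fieldType) := RigidCat {
  rig_mon :> monCat k;
  ldual : rig_mon -> rig_mon;
  ldualP : forall X : rig_mon, dual_pair (ldual X) X;
  rdual : rig_mon -> rig_mon;
  rdualP : forall X : rig_mon, dual_pair X (rdual X);
  ldual_tens : forall X Y : rig_mon, ldual Y ⊗ ldual X = ldual (X ⊗ Y);
  ldual_one : tunit rig_mon = ldual (tunit rig_mon);
  rdual_tens : forall X Y : rig_mon, rdual Y ⊗ rdual X = rdual (X ⊗ Y);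
  rdual_one : tunit rig_mon = rdual (tunit rig_mon);
  ev_ldual_tens : forall X Y : rig_mon,
    ev (ldualP (X ⊗ Y)) ∘ (eqm (ldual_tens X Y) ⊠ idm (X ⊗ Y))
    = tens_ev (ldualP X) (ldualP Y);
  ev_ldual_one :
    ev (ldualP (tunit rig_mon)) ∘ (eqm ldual_one ⊠ idm (tunit rig_mon))
    = unitl (tunit rig_mon);
  ev_rdual_tens : forall X Y : rig_mon,
    ev (rdualP (X ⊗ Y)) ∘ (idm (X ⊗ Y) ⊠ eqm (rdual_tens X Y))
    = tens_ev (rdualP Y) (rdualP X);
  ev_rdual_one :
    ev (rdualP (tunit rig_mon)) ∘ (idm (tunit rig_mon) ⊠ eqm rdual_one)
    = unitl (tunit rig_mon)
}.

Record finTensorCat (k : fieldType) := FinTensorCat {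
  ftc_rig :> rigidCat k;
  ftc_finite : finite_abelian ftc_rig;
  ftc_simple_one : simple_obj (tunit ftc_rig)
}.

Notation "X ^*" := (ldual X) : cat_scope.
Notation "X ^**" := (ldual (ldual X))
  (at level 1, left associativity, format "X ^**") : cat_scope.

Section Pivotal.
Variables (k : fieldType) (C : rigidCat k).
Implicit Types X Y : C.

Definition evl X : mor (X^* ⊗ X) (tunit C) := ev (ldualP X).
Definition coevl X : mor (tunit C) (X ⊗ X^*) := coev (ldualP X).

Definition ldualm X Y (f : mor X Y) : mor Y^* X^* :=
  unitl X^* ∘ (evl Y ⊠ idm X^*) ∘ assoc Y^* Y X^* ∘ (idm Y^* ⊠ (f ⊠ idm X^*))
  ∘ (idm Y^* ⊠ coevl X) ∘ unitrV Y^*.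

(* Strictness of the duality functors turns the monoidal structure of the double
   dual functor into these identities. *)
Definition ldual2_tens X Y : X^** ⊗ Y^** = (X ⊗ Y)^** :=
  etrans (ldual_tens Y^* X^*) (congr1 (@ldual k C) (ldual_tens X Y)).
Definition ldual2_one : tunit C = (tunit C)^** :=
  etrans (ldual_one C) (congr1 (@ldual k C) (ldual_one C)).

Record pivotal := Pivotal {
  piv : forall X, mor X X^**;
  pivV : forall X, mor X^** X;
  pivK : forall X, pivV X ∘ piv X = idm X;
  pivVK : forall X, piv X ∘ pivV X = idm X^**;
  piv_nat : forall X Y (f : mor X Y),
    ldualm (ldualm f) ∘ piv X = piv Y ∘ f;
  piv_tens : forall X Y, piv (X ⊗ Y) = eqm (ldual2_tens X Y) ∘ (piv X ⊠ piv Y);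
  piv_one : piv (tunit C) = eqm ldual2_one
}.

End Pivotal.

Section ModifiedTrace.
Variables (k : fieldType) (C : rigidCat k) (p : pivotal C).

Definition trace_family := forall P : C, projective P -> 'Hom(mor P P, k^o).

(* (id_P ⊗ ev_{X^*}) (f ⊗ id_{X^*}) (id_P ⊗ coev_X) *)
Definition partial_trace (P X : C) (f : mor (P ⊗ X) (P ⊗ X^**)) : mor P P :=
  unitr P ∘ (idm P ⊠ evl X^*) ∘ assocV P X^** X^* ∘ (f ⊠ idm X^*)
  ∘ assoc P X X^* ∘ (idm P ⊠ coevl X) ∘ unitrV P.

(* P ⊗ X is projective whenever P is, so hPX below is always available. *)
Definition right_modified_trace (t : trace_family) : Prop :=
  (forall (P Q : C) (hP : projective P) (hQ : projective Q)
     (f : mor P Q) (g : mor Q P), t P hP (g ∘ f) = t Q hQ (f ∘ g)) /\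
  (forall (P X : C) (hP : projective P) (hPX : projective (P ⊗ X))
     (f : mor (P ⊗ X) (P ⊗ X^**)),
     t P hP (partial_trace f) = t (P ⊗ X) hPX ((idm P ⊠ pivV p X) ∘ f)).

Definition nonzero_trace (t : trace_family) : Prop :=
  exists (P : C) (hP : projective P) (f : mor P P), t P hP f <> 0.

End ModifiedTrace.

Section Nakayama.
Variables (k : fieldType) (C : klincat k).

(* V · M, given by a natural isomorphism
   Hom_C(V · M, N) ≅ Hom_k(V, Hom_C(M, N)). *)
Record copower (V : vectType k) (M : C) := Copower {
  cpob :> C;
  curry : forall N : C, 'Hom(mor cpob N, 'Hom(V, mor M N));
  uncurry : forall N : C, 'Hom(V, mor M N) -> mor cpob N;
  curryK : forall N, cancel (curry N) (@uncurry N);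
  uncurryK : forall N, cancel (@uncurry N) (curry N);
  curry_nat : forall (N N' : C) (g : mor N N') (f : mor cpob N),
    curry N' (g ∘ f) = (postcomp M g \o curry N f)%VF
}.

Definition cpunit V M (c : copower V M) : 'Hom(V, mor M c) :=
  curry c c (idm (cpob c)).

Lemma curryE V M (c : copower V M) (N : C) (f : mor c N) :
  curry c N f = (postcomp M f \o cpunit c)%VF.
Proof. by rewrite -curry_nat compm1. Qed.

Definition precomp (X Y N : C) (f : mor X Y) : 'Hom(mor Y N, mor X N) :=
  lin_of (comp_linl (Z := N) f).

(* The action V · M -> W · M' of phi : V -> W and f : M -> M'. *)
Definition cpmap V W M M' (c : copower V M) (d : copower W M')
    (phi : 'Hom(V, W)) (f : mor M M') : mor c d :=
  uncurry c (precomp d f \o (cpunit d \o phi))%VF.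

Lemma cpmapE V W M M' (c : copower V M) (d : copower W M')
    (phi : 'Hom(V, W)) (f : mor M M') v :
  cpmap c d phi f ∘ cpunit c v = cpunit d (phi v) ∘ f.
Proof.
have := curryE (cpmap c d phi f); rewrite uncurryK => /lfunP/(_ v).
by rewrite !comp_lfunE !lin_ofE.
Qed.

Lemma copower_ext V M (c : copower V M) (N : C) (f g : mor c N) :
  (forall v, f ∘ cpunit c v = g ∘ cpunit c v) -> f = g.
Proof.
move=> fg; apply: (can_inj (curryK (c := c) (N := N))).
by rewrite !curryE; apply/lfunP => v; rewrite !comp_lfunE !lin_ofE.
Qed.

(* Functors C^op × C -> C. *)
Record bifunctor := Bifunctor {
  bob :> C -> C -> C;
  bmap : forall X X' Y Y' : C,
    mor X' X -> mor Y Y' -> mor (bob X Y) (bob X' Y');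
  bmap1 : forall X Y : C, bmap (idm X) (idm Y) = idm (bob X Y);
  bmapM : forall (X X' X'' Y Y' Y'' : C) (f : mor X' X) (f' : mor X'' X')
    (g : mor Y Y') (g' : mor Y' Y''),
    bmap (f ∘ f') (g' ∘ g) = bmap f' g' ∘ bmap f g
}.

Definition cowedge (F : bifunctor) (E : C) (i : forall X, mor (F X X) E) : Prop :=
  forall (X Y : C) (f : mor X Y),
    i X ∘ bmap F f (idm X) = i Y ∘ bmap F (idm Y) f.

Definition is_coend (F : bifunctor) (E : C) : Prop :=
  exists2 i : forall X, mor (F X X) E, cowedge i &
    forall (E' : C) (j : forall X, mor (F X X) E'), cowedge j ->
      exists! h : mor E E', forall X, h ∘ i X = j X.

Section NakayamaIntegrand.
Variables (M : C) (cp : forall X Y : C, copower (dualv (mor M X)) Y).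

(* (X, Y) |-> Hom(M, X)^* · Y *)
Program Definition nakayama_integrand : bifunctor :=
  @Bifunctor (fun X Y => cp X Y)
    (fun X X' Y Y' f g => cpmap (cp X Y) (cp X' Y') (dual_postcomp M f) g) _ _.
Next Obligation.
move=> X Y; apply: copower_ext => v; rewrite cpmapE comp1m compm1.
congr (cpunit _ _); apply/lfunP => x.
by rewrite dual_postcompE comp1m.
Qed.
Next Obligation.
move=> X X' X'' Y Y' Y'' f f' g g'; apply: copower_ext => v.
rewrite cpmapE -compA cpmapE [in RHS]compA cpmapE -compA.
congr (cpunit _ _ ∘ _); apply/lfunP => x.
by rewrite !dual_postcompE compA.
Qed.

End NakayamaIntegrand.

(* N is the value at M of the Nakayama functor; this determines N up to
   isomorphism, independently of the choice of copowers. *)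
Definition is_nakayama (M N : C) : Prop :=
  exists cp : forall X Y : C, copower (dualv (mor M X)) Y,
    is_coend (nakayama_integrand cp) N.

End Nakayama.

Definition unimodular (k : fieldType) (C : monCat k) : Prop :=
  exists2 alpha : C, is_nakayama (tunit C) alpha & isomorphic alpha (tunit C).

(* Main.v *)
Require Import Defs.
From mathcomp Require Import all_boot all_order all_algebra all_field.
From mathcomp Require Import boolp.

(** Let [t] be a modified trace and [P] projective.  The maps [t_P(g f)], for
    [f : P -> 1] and [g : 1 -> P], form a pairing natural in [P].  If
    [t_Q(q) <> 0] and [f <> 0], then [f] is epi because [1] is simple, so
    [f ⊗ Q] splits; this writes [t_Q(q)] as the trace of an endomorphism of
    [P ⊗ Q] factoring through [f ⊗ Q], and the partial trace property turns it
    into [t_P(g f)] for some [g].  The same works for [g <> 0], so a nonzero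
    modified trace yields a perfect pairing, that is, a natural isomorphism
    [Hom(1, P)^* = Hom(P, 1)] on projectives.  This says exactly that [1] is the
    value of the Nakayama functor at [1].

    Conversely, such an isomorphism sends [e : P ⊗ P^* -> 1], the evaluation
    twisted by the pivotal structure, to a functional on [Hom(1, P ⊗ P^* )], which
    is [End(P)] by duality; these functionals form a modified trace.

    For uniqueness, take an eigenvector [f] of the comparison of the pairings of
    two traces [t] and [t']: for its eigenvalue [c], the trace [t' - c t] has a
    degenerate pairing, hence vanishes. *)

Set Implicit Arguments.
Unset Strict Implicit.
Unset Printing Implicit Defensive.
Import GRing.Theory.
Local Open Scope ring_scope.
Local Open Scope cat_scope.

(** * Linear categories *)

Section LinearComposition.
Variables (k : fieldType) (C : klincat k).
Implicit Types X Y Z : C.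

Lemma precompE X Y N (f : mor X Y) (g : mor Y N) : precomp N f g = g ∘ f.
Proof. exact: lin_ofE. Qed.

Lemma comp0m X Y Z (f : mor X Y) : (0 : mor Y Z) ∘ f = 0.
Proof. by rewrite -precompE linear0. Qed.

Lemma compm0 X Y Z (g : mor Y Z) : g ∘ (0 : mor X Y) = 0.
Proof. by rewrite -postcompE linear0. Qed.

Lemma compmBl X Y Z (g h : mor Y Z) (f : mor X Y) : (g - h) ∘ f = (g ∘ f) - (h ∘ f).
Proof. by rewrite -!precompE linearB. Qed.

Lemma compm_suml X Y Z I (r : seq I) (g : I -> mor Y Z) (f : mor X Y) :
  (\sum_(i <- r) g i) ∘ f = \sum_(i <- r) (g i ∘ f).
Proof.
rewrite -precompE linear_sum; apply: eq_bigr => i _. exact: precompE.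
Qed.

Lemma compm_sumr X Y Z I (r : seq I) (g : mor Y Z) (f : I -> mor X Y) :
  g ∘ (\sum_(i <- r) f i) = \sum_(i <- r) (g ∘ f i).
Proof.
rewrite -postcompE linear_sum; apply: eq_bigr => i _; exact: postcompE.
Qed.

Lemma compmZr X Y Z (c : k) (g : mor Y Z) (f : mor X Y) :
  g ∘ (c *: f) = c *: (g ∘ f).
Proof. by rewrite -!postcompE linearZ. Qed.

Lemma epi0 X Y (e : mor X Y) :
  (forall Z (u : mor Y Z), u ∘ e = 0 -> u = 0) -> epi e.
Proof.
move=> e0 Z g h /eqP; rewrite -subr_eq0 -compmBl => /eqP/e0/eqP.
by rewrite subr_eq0 => /eqP.
Qed.

End LinearComposition.

(** * Strict monoidal calculus *)

Section Arrows.
Variables (k : fieldType) (C : monCat k).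
Implicit Types X Y Z W : C.

Definition eq0 X Y : mor X Y :=
  match pselect (X = Y) with left e => eqm e | right _ => 0 end.

Lemma eq0xx X : eq0 X X = idm X.
Proof.
by rewrite /eq0; case: pselect => // e; rewrite (Prop_irrelevance e erefl).
Qed.

(* Morphisms with their source and target forgotten: there the tensor product
   is associative and unital on the nose, which removes the transports [eqm].
   Composition is made total by inserting 0 between different objects. *)
Record arrow := Arr { dm : C; cd : C; mp : mor dm cd }.

Definition acomp (a b : arrow) := Arr (mp a ∘ eq0 (cd b) (dm a) ∘ mp b).
Definition atens (a b : arrow) := Arr (mp a ⊠ mp b).
Definition aid X := Arr (idm X).

Local Notation "a • b" := (acomp a b) (at level 50, left associativity).
Local Notation "a ⊡ b" := (atens a b) (at level 40, left associativity).

(** Composing with [eq0] at both ends recovers a morphism with the fixed source [X] and target [Y],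
    so no equality of dependent pairs has to be inverted. Equations between morphisms can thus be
    checked on arrows. *)
Lemma Arr_inj X Y : injective (@Arr X Y).
Proof.
move=> f g /(congr1 (fun a => eq0 (cd a) Y ∘ mp a ∘ eq0 X (dm a))) /=.
by rewrite !eq0xx !comp1m !compm1.
Qed.

Lemma Arr_comp X Y Z (g : mor Y Z) (f : mor X Y) : Arr (g ∘ f) = Arr g • Arr f.
Proof. by rewrite /acomp /= eq0xx compm1. Qed.

Lemma Arr_tens X Y Z W (g : mor Y Z) (f : mor X W) : Arr (g ⊠ f) = Arr g ⊡ Arr f.
Proof. by []. Qed.

Lemma Arr_eqm_l X Y Z (e : Y = Z) (f : mor X Y) : Arr (eqm e ∘ f) = Arr f.
Proof. by case: _ / e; rewrite comp1m. Qed.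

Lemma Arr_eqm_r X Y Z (e : X = Y) (f : mor Y Z) : Arr (f ∘ eqm e) = Arr f.
Proof. by case: _ / e f => f; rewrite compm1. Qed.

Lemma Arr_eqm X Y (e : X = Y) : Arr (eqm e) = aid X.
Proof. by case: _ / e. Qed.

Lemma acompA a b c : a • (b • c) = (a • b) • c.
Proof. by rewrite /acomp /= !Defs.compA. Qed.

Lemma aid_l X a : cd a = X -> aid X • a = a.
Proof. by case: a => Y Z f /= <-; rewrite /acomp /= eq0xx !comp1m. Qed.

Lemma aid_r X a : dm a = X -> a • aid X = a.
Proof. by case: a => Y Z f /= <-; rewrite /acomp /= eq0xx !compm1. Qed.

Lemma atensA a b c : a ⊡ (b ⊡ c) = (a ⊡ b) ⊡ c.
Proof.
rewrite -[LHS](Arr_eqm_l (tensA _ _ _)) /= tensmA.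
exact: (Arr_eqm_r (tensA _ _ _)).
Qed.

Lemma atens1l a : aid (tunit C) ⊡ a = a.
Proof.
rewrite -[LHS](Arr_eqm_l (tens1l _)) /= tensm1l.
by rewrite (Arr_eqm_r (tens1l _)); case: a.
Qed.

Lemma atens1r a : a ⊡ aid (tunit C) = a.
Proof.
rewrite -[LHS](Arr_eqm_l (tens1r _)) /= tensm1r.
by rewrite (Arr_eqm_r (tens1r _)); case: a.
Qed.

Lemma aid_tens X Y : aid (X ⊗ Y) = aid X ⊡ aid Y.
Proof. by rewrite /aid -tensm1. Qed.

Lemma atensM a b a' b' : cd a = dm a' -> cd b = dm b' ->
  (a' ⊡ b') • (a ⊡ b) = (a' • a) ⊡ (b' • b).
Proof.
case: a a' b b' => [X Y f] [Y' Z f'] [U V g] [V' W g'] /= e e'; subst.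
by rewrite /acomp /atens /= !eq0xx !compm1 tensmM.
Qed.

End Arrows.
Notation "a • b" := (acomp a b) (at level 50, left associativity) : cat_scope.
Notation "a ⊡ b" := (atens a b) (at level 40, left associativity) : cat_scope.

(** [solve_ends] closes side goals about matching endpoints by strictness; [strip_eqm] pushes [Arr]
    inwards and erases the transports. *)
Ltac solve_ends := by rewrite /= ?tensA ?tens1l ?tens1r.
Ltac strip_eqm := rewrite /assoc /assocV /unitl /unitlV /unitr /Defs.unitrV;
  repeat first [rewrite Arr_eqm_l | rewrite Arr_eqm_r | rewrite Arr_comp
    | rewrite Arr_tens].

Section ArrowCalculus.
Variables (k : fieldType) (C : monCat k).
Implicit Types X Y Z : C.
Implicit Types a b c : arrow C.

Lemma whisker_l X a b : cd b = dm a ->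
  aid X ⊡ (a • b) = (aid X ⊡ a) • (aid X ⊡ b).
Proof. by move=> e; rewrite atensM // aid_l. Qed.

Lemma whisker_r X a b : cd b = dm a ->
  (a • b) ⊡ aid X = (a ⊡ aid X) • (b ⊡ aid X).
Proof. by move=> e; rewrite atensM // aid_l. Qed.

(** With [slide_r] this is the interchange law: rewriting forwards with one and backwards with the
    other exchanges two morphisms acting on disjoint strands. *)
Lemma slide_l X Y a b : cd b = X -> dm a = Y ->
  (a ⊡ aid X) • (aid Y ⊡ b) = a ⊡ b.
Proof. by move=> <- <-; rewrite atensM // aid_l // aid_r. Qed.

Lemma slide_r X Y a b : dm b = X -> cd a = Y ->
  (aid Y ⊡ b) • (a ⊡ aid X) = a ⊡ b.
Proof. by move=> <- <-; rewrite atensM // aid_l // aid_r. Qed.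

Lemma dual_zigzag_obj L X (d : dual_pair L X) :
  (aid X ⊡ Arr (ev d)) • (Arr (coev d) ⊡ aid X) = aid X.
Proof. by move: (congr1 (@Arr _ C X X) (zigzag_obj d)); strip_eqm => ->. Qed.

Lemma dual_zigzag_dual L X (d : dual_pair L X) :
  (Arr (ev d) ⊡ aid L) • (aid L ⊡ Arr (coev d)) = aid L.
Proof. by move: (congr1 (@Arr _ C L L) (zigzag_dual d)); strip_eqm => ->. Qed.

End ArrowCalculus.

(** * Duality and partial traces *)

Section Adjunction.
Variables (k : fieldType) (C : rigidCat k).
Implicit Types X Y Z P Q : C.

(** With [bend_left] this is the adjunction between [- ⊗ Q] and [- ⊗ Q^*]. *)
Definition bend_right X Q Z (u : mor (X ⊗ Q) Z) : mor X (Z ⊗ Q^*) :=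
  (u ⊠ idm Q^*) ∘ assoc X Q Q^* ∘ (idm X ⊠ coevl Q) ∘ Defs.unitrV X.

Definition bend_left X Q Z (v : mor X (Z ⊗ Q^*)) : mor (X ⊗ Q) Z :=
  unitr Z ∘ (idm Z ⊠ evl Q) ∘ assocV Z Q^* Q ∘ (v ⊠ idm Q).

Lemma Arr_bend_right X Q Z (u : mor (X ⊗ Q) Z) :
  Arr (bend_right u) = (Arr u ⊡ aid Q^*) • (aid X ⊡ Arr (coevl Q)).
Proof. by rewrite /bend_right; strip_eqm. Qed.

Lemma Arr_bend_left X Q Z (v : mor X (Z ⊗ Q^*)) :
  Arr (bend_left v) = (aid Z ⊡ Arr (evl Q)) • (Arr v ⊡ aid Q).
Proof. by rewrite /bend_left; strip_eqm. Qed.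

Lemma bend_rightK X Q Z : cancel (@bend_right X Q Z) (@bend_left X Q Z).
Proof.
move=> u; apply: Arr_inj; rewrite Arr_bend_left Arr_bend_right.
rewrite whisker_r; last by solve_ends.
rewrite acompA -[Arr u ⊡ _ ⊡ _]atensA -aid_tens slide_r; [|solve_ends..].
rewrite -(slide_l (X := tunit C) (Y := X ⊗ Q)); [|solve_ends..].
rewrite atens1r -acompA aid_tens -!atensA -whisker_l; last by solve_ends.
by rewrite dual_zigzag_obj -aid_tens aid_r.
Qed.

Lemma bend_leftK X Q Z : cancel (@bend_left X Q Z) (@bend_right X Q Z).
Proof.
move=> v; apply: Arr_inj; rewrite Arr_bend_right Arr_bend_left.
rewrite whisker_r; last by solve_ends.
rewrite -acompA -[Arr v ⊡ _ ⊡ _]atensA -aid_tens slide_l; [|solve_ends..].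
rewrite -(slide_r (a := Arr v) (X := tunit C) (Y := Z ⊗ Q^*)); [|solve_ends..].
rewrite atens1r acompA aid_tens -!atensA -whisker_l; last by solve_ends.
by rewrite dual_zigzag_dual -aid_tens aid_l.
Qed.

Lemma bend_right_comp X Y Q Z (u : mor (Y ⊗ Q) Z) (e : mor X Y) :
  bend_right (u ∘ (e ⊠ idm Q)) = bend_right u ∘ e.
Proof.
apply: Arr_inj; rewrite Arr_comp !Arr_bend_right Arr_comp Arr_tens.
rewrite whisker_r // -[Arr e ⊡ _ ⊡ _]atensA -aid_tens -!acompA.
rewrite slide_l; [|solve_ends..].
by rewrite -[Arr e in RHS]atens1r slide_r //; solve_ends.
Qed.

Lemma bend_left_comp X Q Y Z (v : mor X (Y ⊗ Q^*)) (w : mor Y Z) :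
  bend_left ((w ⊠ idm Q^*) ∘ v) = w ∘ bend_left v.
Proof.
apply: Arr_inj; rewrite Arr_comp !Arr_bend_left Arr_comp Arr_tens.
rewrite whisker_r // -[Arr w ⊡ _ ⊡ _]atensA -aid_tens !acompA.
rewrite slide_r; [|solve_ends..].
by rewrite -[Arr w in RHS]atens1r slide_l //; solve_ends.
Qed.

(** [- ⊗ Q] is a left adjoint: two maps out of [Y ⊗ Q] are compared through their bent forms out of
    [Y]. *)
Lemma epi_tensr X Y Q (e : mor X Y) : epi e -> epi (e ⊠ idm Q).
Proof.
move=> epi_e Z u v uv; apply: (can_inj (@bend_rightK _ _ _)).
by apply: epi_e; rewrite -!bend_right_comp uv.
Qed.

(** The right adjoint [- ⊗ Q^*] preserves epimorphisms, so a lifting problem for [P ⊗ Q] bends into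
    one for [P]. *)
Lemma projective_tensr P Q : projective P -> projective (P ⊗ Q).
Proof.
move=> projP X Y e f epi_e.
have [g eg] := projP _ _ _ (bend_right f) (epi_tensr (Q := Q^*) epi_e).
by exists (bend_left g); rewrite -bend_left_comp eg bend_rightK.
Qed.

Lemma projective_split_unit P Q (h : mor P (tunit C)) : epi h -> projective Q ->
  exists s : mor Q (P ⊗ Q), (h ⊠ idm Q) ∘ s = unitlV Q.
Proof. by move=> epi_h projQ; apply: projQ; exact: epi_tensr. Qed.

End Adjunction.

Section StrictDuality.
Variables (k : fieldType) (C : rigidCat k).
Implicit Types X Y Z P Q : C.

(** Strict duality is stated on evaluations only; this carries it over to coevaluations. Inserting
    the zigzag of [d] on the strand [X] and sliding [c] past [coev d] exposes the assumed zigzag for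
    [c]. *)
Lemma coev_unique L X (d : dual_pair L X) (c : arrow C) :
    dm c = tunit C -> cd c = X ⊗ L ->
  (Arr (ev d) ⊡ aid L) • (aid L ⊡ c) = aid L -> c = Arr (coev d).
Proof.
move=> dc cc zz; rewrite -[LHS](aid_l cc) aid_tens -[in aid X ⊡ _](dual_zigzag_obj d).
rewrite whisker_r; last by solve_ends.
rewrite -[in X in _ • X](atens1l c) -acompA -[Arr (coev d) ⊡ _ ⊡ _]atensA -aid_tens.
rewrite slide_l // -(slide_r (a := Arr (coev d)) (X := tunit C) (Y := X ⊗ L)) //.
rewrite atens1r aid_tens.
rewrite acompA -!atensA -whisker_l ?zz -?aid_tens ?aid_l //.
by rewrite /= cc; solve_ends.
Qed.

Lemma Arr_evl_tens X Y :
  Arr (evl (X ⊗ Y)) = Arr (evl Y) • (aid Y^* ⊡ Arr (evl X) ⊡ aid Y).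
Proof.
have := congr1 (@Arr _ C _ _) (ev_ldual_tens X Y); rewrite /tens_ev; strip_eqm.
rewrite Arr_eqm -aid_tens aid_r; last by rewrite /= ldual_tens.
by move=> ->.
Qed.

Lemma Arr_coevl_tens X Y :
  Arr (coevl (X ⊗ Y)) = (aid X ⊡ Arr (coevl Y) ⊡ aid X^*) • Arr (coevl X).
Proof.
symmetry; apply: coev_unique; rewrite //=; first by rewrite -ldual_tens; solve_ends.
rewrite -/(evl _) Arr_evl_tens -(ldual_tens X Y) aid_tens.
(* [evl X] and [coevl Y] act on disjoint strands; exchanging them separates the zigzag of [Y] from
   that of [X]. *)
have swap : (aid Y^* ⊡ Arr (evl X) ⊡ aid Y ⊡ aid Y^* ⊡ aid X^*) •
    (aid Y^* ⊡ aid X^* ⊡ aid X ⊡ Arr (coevl Y) ⊡ aid X^*) =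
    (aid Y^* ⊡ Arr (coevl Y) ⊡ aid X^*) • (aid Y^* ⊡ Arr (evl X) ⊡ aid X^*).
  rewrite -!whisker_r; [|solve_ends..]; congr (_ ⊡ _).
  rewrite -!(atensA (aid Y^*)) -!whisker_l; [|solve_ends..]; congr (_ ⊡ _).
  rewrite -[Arr (evl X) ⊡ _ ⊡ _]atensA -!aid_tens slide_l //.
  rewrite -(slide_r (X := tunit C) (Y := tunit C)) //.
  by rewrite atens1l atens1r.
rewrite -aid_tens whisker_r; last by solve_ends.
rewrite whisker_l; last by solve_ends.
rewrite aid_tens !atensA !acompA -(acompA (Arr (evl Y) ⊡ _ ⊡ _)) swap !acompA.
rewrite -whisker_r; last by solve_ends.
rewrite dual_zigzag_dual -acompA -!(atensA (aid Y^*)) -whisker_l; last by solve_ends.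
by rewrite dual_zigzag_dual -!aid_tens aid_l.
Qed.

Lemma Arr_ldualm X Y (f : mor X Y) :
  Arr (ldualm f) =
  (Arr (evl Y) ⊡ aid X^*) • (aid Y^* ⊡ ((Arr f ⊡ aid X^*) • Arr (coevl X))).
Proof.
by rewrite /ldualm; strip_eqm; rewrite whisker_l ?acompA //; solve_ends.
Qed.

(** Unfolding [ldualm f] and sliding its inner part past [coevl Y] exposes the zigzag of [Y], which
    cancels. *)
Lemma coevl_natural X Y (f : mor X Y) :
  (f ⊠ idm X^*) ∘ coevl X = (idm Y ⊠ ldualm f) ∘ coevl Y.
Proof.
apply: Arr_inj; rewrite !Arr_comp !Arr_tens Arr_ldualm.
rewrite -!/(aid _); set b := (Arr f ⊡ _) • Arr (coevl X).
rewrite whisker_l; last by solve_ends.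
rewrite -acompA !atensA -/(aid Y) -aid_tens.
rewrite -[X in _ • (_ • X)]atens1r slide_r //.
rewrite -(slide_l (b := b) (X := Y ⊗ X^*) (Y := tunit C)) // atens1l acompA.
rewrite aid_tens atensA -whisker_r; last by solve_ends.
by rewrite dual_zigzag_obj -aid_tens aid_l.
Qed.

Lemma evl_natural X Y (f : mor X Y) :
  evl X ∘ (ldualm f ⊠ idm X) = evl Y ∘ (idm Y^* ⊠ f).
Proof.
apply: Arr_inj; rewrite !Arr_comp !Arr_tens Arr_ldualm -!/(aid _).
rewrite whisker_r; last by solve_ends.
rewrite acompA -!atensA -aid_tens.
rewrite -[X in X • (_ ⊡ aid _)]atens1l slide_r //.
rewrite -(slide_l (X := tunit C) (Y := Y^* ⊗ Y)) // atens1r -acompA; congr (_ • _).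
rewrite aid_tens -atensA -whisker_l; last by solve_ends.
congr (_ ⊡ _); rewrite whisker_r // acompA -atensA -aid_tens.
rewrite slide_r; [|solve_ends..].
rewrite -(slide_l (X := tunit C) (Y := X)) // atens1r -acompA dual_zigzag_obj.
by rewrite aid_r.
Qed.

End StrictDuality.

(** * Partial traces in terms of evaluations and coevaluations *)

Section PartialTrace.
Variables (k : fieldType) (C : rigidCat k).
Implicit Types X Y Z P Q : C.

Lemma Arr_partial_trace P X (f : mor (P ⊗ X) (P ⊗ X^**)) :
  Arr (partial_trace f) = (aid P ⊡ Arr (evl X^*)) • (Arr f ⊡ aid X^*)
    • (aid P ⊡ Arr (coevl X)).
Proof. by rewrite /partial_trace; strip_eqm. Qed.

(** The partial trace closes a loop on the strand of [Q] alone, so [f] slides out below the loop,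
    and what remains above is the required [g]. *)
Lemma partial_trace_factor_l P Q (f : mor P (tunit C)) (w : mor Q (P ⊗ Q^**)) :
  exists g : mor (tunit C) P,
    partial_trace (w ∘ unitl Q ∘ (f ⊠ idm Q)) = g ∘ f.
Proof.
exists (unitr P ∘ (idm P ⊠ evl Q^*) ∘ assocV P Q^** Q^* ∘ (w ⊠ idm Q^*) ∘ coevl Q).
apply: Arr_inj; rewrite Arr_partial_trace; strip_eqm.
rewrite whisker_r; last by solve_ends.
rewrite -!acompA -atensA -[aid Q ⊡ _]aid_tens slide_l //.
by rewrite -(slide_r (a := Arr f) (X := tunit C) (Y := tunit C)) // atens1r atens1l.
Qed.

Lemma partial_trace_factor_r P Q (g : mor (tunit C) P) (w : mor (P ⊗ Q) Q^**) :
  exists f : mor P (tunit C),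
    partial_trace ((g ⊠ idm Q^**) ∘ unitlV Q^** ∘ w) = g ∘ f.
Proof.
exists (evl Q^* ∘ bend_right w).
apply: Arr_inj; rewrite Arr_partial_trace 2!Arr_comp; strip_eqm.
rewrite Arr_eqm aid_r; last by solve_ends.
rewrite -!/(aid _) whisker_r; last by solve_ends.
rewrite !acompA -atensA -[aid Q^** ⊡ _]aid_tens slide_r //.
by rewrite -(slide_l (a := Arr g) (X := tunit C) (Y := tunit C)) // atens1r atens1l.
Qed.

(** The image of [f] under the duality isomorphism from [Hom(P, Q)] to the morphisms from the unit
    to [Q ⊗ P^*]. *)
Definition bend P Q (f : mor P Q) : mor (tunit C) (Q ⊗ P^*) :=
  (f ⊠ idm P^*) ∘ coevl P.

(* The map P ⊗ (X^** ⊗ X^* ) ⊗ P^* -> P ⊗ P^*, as (P ⊗ X)^* = X^* ⊗ P^*. *)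
Definition cap P X : mor ((P ⊗ X^**) ⊗ (P ⊗ X)^*) (P ⊗ P^*) :=
  (unitr P ⊠ idm P^*) ∘ ((idm P ⊠ evl X^*) ⊠ idm P^*)
  ∘ (assocV P X^** X^* ⊠ idm P^*) ∘ assoc (P ⊗ X^**) X^* P^*
  ∘ (idm (P ⊗ X^**) ⊠ eqm (esym (ldual_tens P X))).

Lemma Arr_cap P X : Arr (cap P X) = aid P ⊡ Arr (evl X^*) ⊡ aid P^*.
Proof.
rewrite /cap; strip_eqm; rewrite !Arr_eqm -!/(aid _) -!aid_tens.
rewrite -(ldual_tens P X) tensA.
by rewrite !aid_r ?aid_l //; solve_ends.
Qed.

(** The coevaluation of [P ⊗ X] nests that of [X] inside that of [P], so only the inner evaluation
    of the loop remains to be applied to [bend f]. *)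
Lemma bend_partial_trace P X (f : mor (P ⊗ X) (P ⊗ X^**)) :
  bend (partial_trace f) = cap P X ∘ bend f.
Proof.
apply: Arr_inj; rewrite [RHS]Arr_comp Arr_cap !Arr_comp !Arr_tens Arr_partial_trace.
rewrite Arr_coevl_tens -!/(aid _).
rewrite !whisker_r; [|solve_ends..].
by rewrite -[in RHS](ldual_tens P X) aid_tens !atensA !acompA.
Qed.

Variable p : pivotal C.

(** The pivotal structure makes [P^*] a right dual of [P] as well, with this evaluation. *)
Definition pev P : mor (P ⊗ P^*) (tunit C) := evl P^* ∘ (piv p P ⊠ idm P^*).

Lemma pev_natural P Q (g : mor Q P) :
  pev P ∘ (g ⊠ idm P^*) = pev Q ∘ (idm Q ⊠ ldualm g).
Proof.
rewrite /pev -!Defs.compA -!tensmM comp1m -piv_nat comp1m compm1.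
have -> : (ldualm (ldualm g) ∘ piv p Q) ⊠ idm P^* =
    (ldualm (ldualm g) ⊠ idm P^*) ∘ (piv p Q ⊠ idm P^*).
  by rewrite -tensmM comp1m.
by rewrite Defs.compA evl_natural -Defs.compA -tensmM comp1m compm1.
Qed.

(** This rests on monoidality of the pivotal structure: [piv p (P ⊗ X)] corrected by [pivV p X] is
    [piv p P] on the first factor only, and the evaluation of [(P ⊗ X)^*] nests that of [X^*] inside
    that of [P^*]. *)
Lemma pev_cap P X :
  pev P ∘ cap P X = pev (P ⊗ X) ∘ ((idm P ⊠ pivV p X) ⊠ idm (P ⊗ X)^*).
Proof.
have E : piv p (P ⊗ X) ∘ (idm P ⊠ pivV p X) =
    eqm (ldual2_tens P X) ∘ (piv p P ⊠ idm X^**).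
  by rewrite piv_tens -Defs.compA -tensmM compm1 pivVK.
rewrite /pev -[RHS]Defs.compA -tensmM comp1m E.
apply: Arr_inj; rewrite [LHS]Arr_comp Arr_cap !Arr_comp !Arr_tens.
rewrite Arr_eqm_l Arr_tens -(ldual_tens P X).
rewrite Arr_evl_tens -!/(aid _) aid_tens.
rewrite -acompA -[in RHS]acompA; congr (_ • _).
rewrite !atensA -!whisker_r; [|solve_ends..]; congr (_ ⊡ _).
rewrite -[X in X • _]atens1r slide_l //.
by rewrite -atensA -aid_tens slide_r.
Qed.

End PartialTrace.

(** * Modified traces *)

Section ModifiedTraces.
Variables (k : fieldType) (C : rigidCat k) (p : pivotal C).
Implicit Types X Y Z P Q : C.

Section Nondegeneracy.
Hypothesis epi_to_unit : forall X (f : mor X (tunit C)), f <> 0 -> epi f.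
Variable t : trace_family C.
Hypothesis rmt : right_modified_trace p t.
Variables (Q : C) (hQ : projective Q) (q : mor Q Q).
Hypothesis tq : t hQ q <> 0.

Lemma trace_nondegenerate_l P (hP : projective P) (f : mor P (tunit C)) :
  f <> 0 -> exists g : mor (tunit C) P, t hP (g ∘ f) <> 0.
Proof.
move=> f0; have [s fs] := projective_split_unit (epi_to_unit f0) hQ.
have hPQ : projective (P ⊗ Q) by exact: projective_tensr.
(* [piv p Q] is inserted to cancel the [pivV p Q] of the partial trace property; cyclicity then
   moves [f ⊠ idm Q] next to its section [s], leaving [t hQ q]. *)
have [g gE] := partial_trace_factor_l f ((idm P ⊠ piv p Q) ∘ s ∘ q).
exists g; rewrite -gE (rmt.2 _ _ hP hPQ) !Defs.compA -tensmM pivK comp1m tensm1.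
rewrite comp1m -!Defs.compA (rmt.1 _ _ hPQ hQ) -!Defs.compA fs.
rewrite [unitl Q ∘ _](_ : _ = idm Q) ?compm1 //.
by apply: Arr_inj; rewrite Arr_eqm_l Arr_eqm.
Qed.

Lemma trace_nondegenerate_r P (hP : projective P) (g : mor (tunit C) P) :
  g <> 0 -> exists f : mor P (tunit C), t hP (g ∘ f) <> 0.
Proof.
move=> g0; set R := rdual P; pose d : dual_pair P R := rdualP P.
pose mate : mor R (tunit C) := ev d ∘ (g ⊠ idm R) ∘ unitlV R.
(* The mate of a nonzero g is nonzero, so g ⊗ Q splits because mate ⊗ Q does. *)
have mateE : g = unitl P ∘ (mate ⊠ idm P) ∘ coev d.
  apply: Arr_inj; rewrite /mate; strip_eqm.
  rewrite -!/(aid _) whisker_r; last by solve_ends.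
  rewrite -atensA -aid_tens -acompA -[X in _ • (_ • X)]atens1l.
  rewrite slide_l //.
  rewrite -(slide_r (a := Arr g) (X := tunit C) (Y := P)) // atens1r acompA.
  by rewrite dual_zigzag_dual aid_l.
have mate0 : mate <> 0.
  move=> m0; apply: g0; rewrite mateE m0.
  by rewrite -(lin_ofE (tensm_linl (idm P))) linear0 compm0 comp0m.
have [s ms] := projective_split_unit (epi_to_unit mate0) hQ.
(* Bending the section [s] of [mate ⊠ idm Q] along [d] gives a retraction of [g ⊠ idm Q]. *)
pose r := unitl Q ∘ (ev d ⊠ idm Q) ∘ assoc P R Q ∘ (idm P ⊠ s).
have rg : r ∘ (g ⊠ idm Q) ∘ unitlV Q = idm Q.
  have := congr1 (@Arr _ C _ _) ms; rewrite /r /mate; strip_eqm.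
  rewrite Arr_eqm -!/(aid _) => {}ms.
  apply: Arr_inj; rewrite /r; strip_eqm; rewrite -!/(aid _) -[RHS]ms.
  rewrite whisker_r; last by solve_ends.
  rewrite -!acompA slide_r //; congr (_ • _).
  by rewrite -atensA -aid_tens -[X in _ = _ • X]atens1l slide_l.
clearbody r; have hPQ : projective (P ⊗ Q) by exact: projective_tensr.
have [f fE] := partial_trace_factor_r g (piv p Q ∘ q ∘ r).
exists f; rewrite -fE (rmt.2 _ _ hP hPQ).
suff -> : (idm P ⊠ pivV p Q) ∘ ((g ⊠ idm Q^**) ∘ unitlV Q^** ∘ (piv p Q ∘ q ∘ r))
    = (g ⊠ idm Q) ∘ unitlV Q ∘ (q ∘ r).
  by rewrite (rmt.1 _ _ hPQ hQ) -!Defs.compA [r ∘ _]Defs.compA rg compm1.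
have -> : (g ⊠ idm Q^**) ∘ unitlV Q^** ∘ (piv p Q ∘ q ∘ r)
    = (idm P ⊠ piv p Q) ∘ ((g ⊠ idm Q) ∘ unitlV Q ∘ (q ∘ r)).
  rewrite !Defs.compA; congr (_ ∘ q ∘ r).
  apply: Arr_inj; rewrite Arr_comp Arr_eqm_r [RHS]Arr_comp.
  rewrite !Arr_comp !Arr_eqm !Arr_tens -!/(aid _) -[Arr (piv p Q) in LHS]atens1l.
  rewrite slide_l // -[in RHS]acompA aid_r; last by solve_ends.
  by rewrite slide_r.
by rewrite Defs.compA -tensmM pivK comp1m tensm1 comp1m.
Qed.

End Nondegeneracy.

Lemma bend_comp_l P Q R (f : mor P Q) (g : mor Q R) :
  bend (g ∘ f) = (g ⊠ idm P^*) ∘ bend f.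
Proof. by rewrite /bend Defs.compA -tensmM comp1m. Qed.

Lemma bend_comp_r P Q R (f : mor P Q) (g : mor Q R) :
  bend (g ∘ f) = (idm R ⊠ ldualm f) ∘ bend g.
Proof.
rewrite bend_comp_l /bend coevl_natural !Defs.compA -!tensmM.
by rewrite !comp1m !compm1.
Qed.

Lemma bend_surj P (g : mor (tunit C) (P ⊗ P^*)) : exists f : mor P P, bend f = g.
Proof.
exists (bend_left g ∘ unitlV P); apply: Arr_inj.
rewrite -[in RHS](bend_leftK g) Arr_bend_right [LHS]Arr_comp Arr_tens.
by rewrite /unitlV Arr_eqm_r atens1l.
Qed.

(** As [piv] is invertible, a vanishing [pev p P] makes the evaluation of [P^*] vanish; its zigzag
    then kills the identity of [P^**], hence that of [P]. *)
Lemma pev_neq0 P : idm P <> 0 -> pev p P <> 0.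
Proof.
move=> P0 pe0; apply: P0.
have ev0 : evl P^* = 0.
  rewrite -[LHS]compm1 -tensm1 -(pivVK p P) -[idm P^*]comp1m tensmM Defs.compA.
  by rewrite -/(pev p P) pe0 comp0m.
have := zigzag_dual (ldualP P^*); rewrite -/(evl _) ev0.
rewrite -(lin_ofE (tensm_linl _)) linear0 compm0 !comp0m => id0.
by rewrite -(pivK p P) -[piv p P]comp1m -id0 comp0m compm0.
Qed.

Section Construction.
Variable lam : forall P, projective P ->
  'Hom(mor P (tunit C), dualv (mor (tunit C) P)).
Hypothesis lam_natural : forall P Q (hP : projective P) (hQ : projective Q)
  (h : mor P Q) (f : mor Q (tunit C)) (g : mor (tunit C) P),
  (lam hP (f ∘ h) : dualv _) g = (lam hQ f : dualv _) (h ∘ g).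

Definition trace_of : trace_family C := fun P hP =>
  ((lam (projective_tensr hP) (pev p P) : dualv _)
     \o (precomp _ (coevl P) \o lin_of (@tensm_linl k C P P P^* P^* (idm P^*))))%VF.

Lemma trace_ofE P (hP : projective P) (f : mor P P) :
  trace_of hP f = (lam (projective_tensr hP) (pev p P) : dualv _) (bend f).
Proof. by rewrite !comp_lfunE precompE lin_ofE. Qed.

(** For cyclicity, [g] passes from [bend] to [pev] by naturality of [lam], crosses to the dual
    strand by [pev_natural], and returns as [ldualm g]. For the partial trace, [cap] passes to [pev]
    in the same way and [pev_cap] turns it into [pivV]. *)
Lemma trace_of_modified : right_modified_trace p trace_of.
Proof.
split=> [P Q hP hQ f g|P X hP hPX f]; rewrite !trace_ofE.
  have hQP : projective (Q ⊗ P^*) by exact: projective_tensr.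
  rewrite bend_comp_l -(lam_natural hQP) pev_natural.
  by rewrite bend_comp_r (lam_natural _ (projective_tensr hQ)).
have hZ : projective ((P ⊗ X^**) ⊗ (P ⊗ X)^*).
  by apply: projective_tensr; exact: projective_tensr.
rewrite bend_partial_trace -(lam_natural hZ) pev_cap bend_comp_l.
by rewrite (lam_natural _ (projective_tensr hPX)).
Qed.

Lemma trace_of_nonzero P (hP : projective P) : idm P <> 0 ->
  (forall Q (hQ : projective Q) (f : mor Q (tunit C)), lam hQ f = 0 -> f = 0) ->
  nonzero_trace trace_of.
Proof.
move=> P0 lam_inj; exists P, hP; apply: contrapT => t0.
apply: (pev_neq0 P0); apply: (lam_inj _ (projective_tensr hP)).
apply/lfunP => g; rewrite zero_lfunE; have [f <-] := bend_surj g.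
by apply: contrapT => tf; apply: t0; exists f; rewrite trace_ofE.
Qed.

End Construction.
End ModifiedTraces.

(** * Finite abelian categories *)

Section ModuleConstructions.
Variables (k : fieldType) (A : falgType k).
Implicit Types M N : modcat A.

Section Build.
Variables (V : vectType k) (act : A -> V -> V).
Hypothesis act_linl : forall v, linear (act^~ v).
Hypothesis act_linr : forall a, linear (act a).
Hypothesis act_1 : forall v, act 1 v = v.
Hypothesis act_M : forall a b v, act (a * b) v = act a (act b v).

Lemma build_mod_linear : linear (fun a => lin_of (act_linr a)).
Proof.
move=> c a b; apply/lfunP => v; rewrite add_lfunE scale_lfunE !lin_ofE.
exact: act_linl.
Qed.

Program Definition build_mod : fdmod A := @FdMod k A V (lin_of build_mod_linear) _ _.
Next Obligation. by apply/lfunP => v; rewrite id_lfunE !lin_ofE act_1. Qed.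
Next Obligation.
by apply/lfunP => v; rewrite comp_lfunE !lin_ofE act_M.
Qed.

Lemma build_modE a v : mact build_mod a v = act a v.
Proof. by rewrite !lin_ofE. Qed.

End Build.

Definition app M N (f : mor M N) (x : M) : N := vsval f x.

Lemma app_act M N (f : mor M N) a x : app f (mact M a x) = mact N a (app f x).
Proof. by rewrite /app (modhomP _ (subvsP f)). Qed.

Lemma app_comp M N Q (g : mor N Q) (f : mor M N) x : app (g ∘ f) x = app g (app f x).
Proof. by rewrite /app /= comp_lfunE. Qed.

Lemma app_id M x : app (idm M) x = x.
Proof. by rewrite /app /= id_lfunE. Qed.

Lemma app_linear M N (f : mor M N) : linear (app f).
Proof. by move=> c x y; rewrite /app linearP. Qed.

Lemma app_linearl M N (x : M) : linear (fun f : mor M N => app f x).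
Proof. by move=> c f g; rewrite /app linearP add_lfunE scale_lfunE. Qed.

Lemma app_ext M N (f g : mor M N) : (forall x, app f x = app g x) -> f = g.
Proof. by move=> fg; apply: val_inj; apply/lfunP. Qed.

Lemma build_hom M N (f : M -> N) : linear f ->
  (forall a x, f (mact M a x) = mact N a (f x)) ->
  exists h : mor M N, forall x, app h x = f x.
Proof.
move=> lf fA.
have hA : lin_of lf \in modhom M N by apply/modhomP => a m; rewrite !lin_ofE.
by exists (Subvs hA) => x; rewrite /app /= lin_ofE.
Qed.

(** The module [A] itself, presented as free on the generator [one] with coordinate [coeff], so that
    its carrier can stay hidden. *)
Lemma regular_module : exists M (one : M) (coeff : M -> A),
  [/\ linear coeff, coeff one = 1, forall x, mact M (coeff x) one = x
    & forall a x, coeff (mact M a x) = a * coeff x].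
Proof.
have l1 (v : A) : linear (fun a : A => a * v).
  by move=> c a b; rewrite mulrDl scalerAl.
have l2 (a : A) : linear (fun v : A => a * v).
  by move=> c v w; rewrite mulrDr scalerAr.
exists (build_mod l1 l2 (@mul1r A) (fun a b v => esym (mulrA a b v))), 1, id.
by split=> // x; rewrite ?build_modE ?mulr1 // => y; rewrite build_modE.
Qed.

Lemma kernel_module M N (u : mor M N) : exists K (i : mor K M),
  (forall x y, app i x = app i y -> x = y) /\
  (forall x, app u x = 0 <-> exists y, x = app i y).
Proof.
pose U := lker (vsval u).
have UA a (v : subvs_of U) : mact M a (vsval v) \in U.
  rewrite memv_ker -/(app u _) app_act /app.
  by have /[!memv_ker]/eqP -> := subvsP v; rewrite linear0.
have l1 (v : subvs_of U) : linear (fun a : A => Subvs (UA a v)).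
  by move=> c a b; apply: val_inj; rewrite /= linearP add_lfunE scale_lfunE.
have l2 (a : A) : linear (fun v => Subvs (UA a v)).
  by move=> c v w; apply: val_inj; rewrite /= !linearP.
have a1 (v : subvs_of U) : Subvs (UA 1 v) = v.
  by apply: val_inj; rewrite /= act1 id_lfunE.
have aM a b (v : subvs_of U) : Subvs (UA (a * b) v) = Subvs (UA a (Subvs (UA b v))).
  by apply: val_inj; rewrite /= actM comp_lfunE.
pose K : modcat A := build_mod l1 l2 a1 aM.
have [||i iE] := @build_hom K M (fun v : subvs_of U => vsval v).
- by move=> c v w; rewrite linearP.
- by move=> a v; rewrite build_modE.
exists K, i; split=> [x y|x]; first by rewrite !iE => /val_inj.
split=> [/eqP ux|[y ->]].
  have xU : x \in U by rewrite memv_ker.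
  by exists (Subvs xU : K); rewrite iE.
by rewrite iE; apply/eqP; have := subvsP (y : subvs_of U); rewrite memv_ker.
Qed.

Lemma power_module n M : exists S (i : 'I_n -> mor M S) (q : 'I_n -> mor S M),
  (forall a b, q a ∘ i b = if a == b then idm M else 0) /\
  \sum_a (i a ∘ q a) = idm S.
Proof.
pose V : vectType k := {ffun 'I_n -> M}.
pose act (a : A) (v : V) : V := [ffun j => mact M a (v j)].
have l1 v : linear (act^~ v).
  by move=> c a b; apply/ffunP => j; rewrite !ffunE linearP add_lfunE scale_lfunE.
have l2 a : linear (act a).
  by move=> c v w; apply/ffunP => j; rewrite !ffunE linearP.
have a1 v : act 1 v = v by apply/ffunP => j; rewrite !ffunE act1 id_lfunE.
have aM a b v : act (a * b) v = act a (act b v).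
  by apply/ffunP => j; rewrite !ffunE actM comp_lfunE.
pose S : modcat A := build_mod l1 l2 a1 aM.
have /choice[i iE] b : exists h : mor M S, forall x,
    app h x = [ffun j => if j == b then x else 0] :> V.
  apply: build_hom => [c x y|a x]; apply/ffunP => j.
    by rewrite !ffunE; case: eqP => _ //; rewrite scaler0 addr0.
  by rewrite build_modE !ffunE; case: eqP => _ //; rewrite linear0.
have /choice[q qE] b : exists h : mor S M, forall x, app h x = (x : V) b.
  apply: build_hom => [c x y|a x]; first by rewrite !ffunE.
  by rewrite build_modE ffunE.
exists S, i, q; split=> [a b|].
  apply: app_ext => x; rewrite app_comp qE iE ffunE.
  by case: eqP => _; rewrite ?app_id // /app /= zero_lfunE.
apply: app_ext => x; rewrite app_id.
rewrite -[LHS](lin_ofE (app_linearl (M := S) (N := S) x)) linear_sum /=.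
apply/ffunP => j; rewrite sum_ffunE (bigD1 j) //= big1 => [|a /negPf aj].
  by rewrite addr0 lin_ofE app_comp qE iE ffunE eqxx.
by rewrite lin_ofE app_comp qE iE ffunE eq_sym aj.
Qed.

(* Q is the coinduced module Hom_k(A, N). *)
Lemma coinduced_separates M N (u : mor M N) (y : N) :
  (forall x, app u x <> y) -> exists Q (f g : mor N Q), f ∘ u = g ∘ u /\ f <> g.
Proof.
move=> uy; pose V : vectType k := 'Hom(A, N).
have lr (a : A) : linear (fun x : A => x * a).
  by move=> c x z; rewrite mulrDl scalerAl.
pose act (a : A) (v : V) : V := (v \o lin_of (lr a))%VF.
have actE a v x : act a v x = v (x * a) by rewrite comp_lfunE lin_ofE.
have l1 v : linear (act^~ v).
  move=> c a b; apply/lfunP => x; rewrite add_lfunE scale_lfunE !actE.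
  by rewrite mulrDr -scalerAr linearP.
have l2 a : linear (act a).
  move=> c v w; apply/lfunP => x.
  by rewrite add_lfunE scale_lfunE !actE add_lfunE scale_lfunE.
have a1 v : act 1 v = v by apply/lfunP => x; rewrite actE mulr1.
have aM a b v : act (a * b) v = act a (act b v).
  by apply/lfunP => x; rewrite !actE mulrA.
pose Q : modcat A := build_mod l1 l2 a1 aM.
(* A linear map out of [N] induces a module map into the coinduced module. Applied to [r], whose
   kernel is the submodule [U], it vanishes on the image of [u], while its value on [y], evaluated
   at [1], is [r y]. *)
pose U := limg (vsval u); pose r : 'End(N) := (\1 - projv U)%VF.
have rE v : r v = v - projv U v by rewrite add_lfunE opp_lfunE id_lfunE.
have la (v : N) : linear (fun a : A => mact N a v).
  by move=> c a b; rewrite linearP add_lfunE scale_lfunE.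
have laE v a : lin_of (la v) a = mact N a v by exact: lin_ofE.
have [|a v|f fE] := @build_hom N Q (fun v : N => (r \o lin_of (la v))%VF : V).
- move=> c v w; apply/lfunP => a; rewrite add_lfunE scale_lfunE !comp_lfunE.
  by rewrite !laE !linearP.
- apply/lfunP => x; rewrite build_modE actE !comp_lfunE !laE actM.
  by rewrite comp_lfunE.
exists Q, f, 0; split.
  apply: app_ext => x; rewrite comp0m app_comp fE; apply/lfunP => a.
  rewrite [in RHS]/app /= !zero_lfunE comp_lfunE laE -app_act rE.
  by rewrite projv_id ?subrr // memv_img // memvf.
move=> f0; have := congr1 (fun v : V => v 1) (fE y).
rewrite f0 comp_lfunE laE act1 id_lfunE rE /app /= !zero_lfunE.
move/esym/eqP; rewrite subr_eq0 => /eqP yU.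
have /memv_imgP[x _ yE] : y \in U by rewrite yU memv_proj.
by apply: (uy x).
Qed.

End ModuleConstructions.

Definition biproduct_power (k : fieldType) (C : klincat k) n (M S : C)
    (i : 'I_n -> mor M S) (q : 'I_n -> mor S M) : Prop :=
  (forall a b, q a ∘ i b = if a == b then idm M else 0) /\
  \sum_a (i a ∘ q a) = idm S.

Section Generators.
Variables (k : fieldType) (C : klincat k).

(* Together, [separating] and [dense] say that Hom(G0, -) is a fully faithful
   functor to right End(G0)-modules; [realizing] says it is essentially
   surjective. *)
Definition separating (G0 : C) : Prop := forall X Y (f g : mor X Y),
  (forall x : mor G0 X, f ∘ x = g ∘ x) -> f = g.

Definition dense (G0 : C) : Prop :=
  forall X Y (phi : mor G0 X -> mor G0 Y), linear phi ->
    (forall x b, phi (x ∘ b) = phi x ∘ b) -> exists h, forall x, h ∘ x = phi x.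

Definition realizing (G0 : C) : Prop :=
  forall (W : vectType k) (act : W -> mor G0 G0 -> W),
    (forall b, linear (act^~ b)) -> (forall w, linear (act w)) ->
    (forall w, act w (idm G0) = w) ->
    (forall w b b', act w (b ∘ b') = act (act w b) b') ->
  exists N (th : W -> mor G0 N),
    [/\ linear th, bijective th & forall w b, th (act w b) = th w ∘ b].

End Generators.

(** * Transfer from modules along an equivalence *)

Section Transfer.
Variables (k : fieldType) (C : klincat k) (A : falgType k).
Variables (F : klfunctor C (modcat A)) (G : klfunctor (modcat A) C).
Variables (eta : forall X : C, mor X (G (F X))).
Variables (eps : forall Y : modcat A, mor (F (G Y)) Y).
Hypothesis eta_iso : forall X, is_iso (eta X).
Hypothesis eps_iso : forall Y, is_iso (eps Y).
Hypothesis eta_natural : forall (X X' : C) (f : mor X X'),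
  eta X' ∘ f = fmap G _ _ (fmap F _ _ f) ∘ eta X.
Hypothesis eps_natural : forall (Y Y' : modcat A) (g : mor Y Y'),
  g ∘ eps Y = eps Y' ∘ fmap F _ _ (fmap G _ _ g).
Implicit Types X Y Z : C.

Lemma faithful_F X Y (f g : mor X Y) : fmap F _ _ f = fmap F _ _ g -> f = g.
Proof.
move=> fg; have [e [eK _]] := eta_iso Y.
by rewrite -(comp1m f) -(comp1m g) -eK -!Defs.compA !eta_natural fg.
Qed.

(** [eps] makes [G] faithful, so the candidate need only be compared with [h] after applying [G],
    where naturality of [eta] computes it. *)
Lemma full_F X Y (h : mor (F X) (F Y)) : exists f, fmap F _ _ f = h.
Proof.
have faithful_G (M N : modcat A) (f g : mor M N) :
    fmap G _ _ f = fmap G _ _ g -> f = g.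
  move=> fg; have [e [_ eK]] := eps_iso M.
  by rewrite -(compm1 f) -(compm1 g) -eK !Defs.compA !eps_natural fg.
have [e [eK Ke]] := eta_iso Y; have [d [dK Kd]] := eta_iso X.
exists (e ∘ fmap G _ _ h ∘ eta X); apply: faithful_G.
rewrite -[LHS]compm1 -Kd Defs.compA -eta_natural !Defs.compA Ke comp1m.
by rewrite -Defs.compA Kd compm1.
Qed.

Lemma eps_inv : exists epsV : forall M, mor M (F (G M)),
  (forall M, epsV M ∘ eps M = idm _) /\ (forall M, eps M ∘ epsV M = idm _).
Proof.
exists (fun M => projT1 (cid (eps_iso M))).
by split=> M; have [] := projT2 (cid (eps_iso M)).
Qed.

Lemma powers n (M : C) : exists S i q, @biproduct_power k C n M S i q.
Proof.
have [S [i [q [qi iq]]]] := power_module n (F M).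
have [epsV [epsVK epsK]] := eps_inv.
have /choice[i' iE] a := full_F (epsV S ∘ i a : mor (F M) (F (G S))).
have /choice[q' qE] a := full_F (q a ∘ eps S : mor (F (G S)) (F M)).
exists (G S), i', q'; split=> [a b|]; apply: faithful_F.
  rewrite fmapM qE iE Defs.compA -[q a ∘ _ ∘ _]Defs.compA epsK compm1 qi.
  by case: eqP; rewrite ?fmap1 ?linear0.
rewrite linear_sum fmap1 -epsVK -[eps S]comp1m -iq compm_suml compm_sumr.
apply: eq_bigr => a _; apply: etrans (fmapM _ _ _) _.
by rewrite qE iE !Defs.compA.
Qed.

Lemma kernels X Y (u : mor X Y) : exists S (i : mor S X), mono i /\ u ∘ i = 0 /\
  forall Z (f : mor Z X), u ∘ f = 0 -> exists g, f = i ∘ g.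
Proof.
have [K [i0 [i0_inj i0_ker]]] := kernel_module (fmap F _ _ u).
have [epsV [epsVK epsK]] := eps_inv.
have [i iE] := full_F (i0 ∘ eps K : mor (F (G K)) (F X)).
exists (G K), i; split=> [Z g h igh|]; last split=> [|Z f uf0].
- apply: faithful_F; rewrite -[LHS]comp1m -[RHS]comp1m -epsVK -!Defs.compA.
  congr (_ ∘ _); apply: app_ext => x; apply: i0_inj.
  by rewrite -!app_comp !Defs.compA -iE -!fmapM igh.
- apply: faithful_F; rewrite fmapM iE linear0; apply: app_ext => x.
  rewrite [RHS]/app zero_lfunE !app_comp.
  by apply/i0_ker; exists (app (eps K) x).
(* Preimages are chosen pointwise; injectivity of [i0] forces the choice to be a module map. *)
have /choice[h0 h0E] x : exists y, app (fmap F _ _ f) x = app i0 y.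
  apply/i0_ker; rewrite -app_comp -fmapM uf0 linear0.
  by rewrite /app zero_lfunE.
have [||h hE] := @build_hom _ _ (F Z) K h0.
- move=> c x y; apply: i0_inj.
  by rewrite -h0E app_linear [RHS]app_linear -!h0E.
- by move=> a x; apply: i0_inj; rewrite -h0E !app_act -h0E.
have [g gE] := full_F (epsV K ∘ h : mor (F Z) (F (G K))).
exists g; apply: faithful_F; rewrite fmapM iE gE; apply: app_ext => x.
by rewrite -Defs.compA [eps K ∘ _]Defs.compA epsK comp1m app_comp hE h0E.
Qed.

(** If [y] were missed, two distinct module maps would agree after [e]; fullness of [F] pulls them
    back to [C], against [epi e]. *)
Lemma epi_surjective X Y (e : mor X Y) (y : F Y) :
  epi e -> exists x, app (fmap F _ _ e) x = y.
Proof.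
move=> epi_e; apply: contrapT => ey.
have [|Q [f [g [fg nfg]]]] := @coinduced_separates _ _ _ _ (fmap F _ _ e) y.
  by move=> x xy; apply: ey; exists x.
have [epsV [epsVK epsK]] := eps_inv.
have [f' fE] := full_F (epsV Q ∘ f : mor (F Y) (F (G Q))).
have [g' gE] := full_F (epsV Q ∘ g : mor (F Y) (F (G Q))).
apply: nfg; rewrite -[f]comp1m -[g]comp1m -epsK -!Defs.compA -fE -gE.
congr (_ ∘ fmap F _ _ _); apply: epi_e; apply: faithful_F.
by rewrite !fmapM fE gE -!Defs.compA fg.
Qed.

(** [G0] corresponds to the regular module, and evaluation [val] at its generator identifies
    [Hom(G0, X)] with the elements of [F X]. Surjectivity of epimorphisms gives projectivity, and
    composition with [mul a] corresponds to the action of [a]. *)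
Lemma generator : exists G0 : C,
  projective G0 /\ separating G0 /\ dense G0 /\ realizing G0.
Proof.
have [R [one [coeff [coeff_lin coeff1 coeffK coeffM]]]] := regular_module A.
have [epsV [epsVK epsK]] := eps_inv.
pose G0 := G R; pose u : F G0 := app (epsV R) one.
pose co (z : F G0) : A := coeff (app (eps R) z).
have coK z : mact (F G0) (co z) u = z.
  by rewrite -app_act coeffK -app_comp epsVK app_id.
have coM a z : co (mact (F G0) a z) = a * co z.
  by rewrite /co app_act coeffM.
have co1 : co u = 1 by rewrite /co -app_comp epsK app_id.
pose val X (f : mor G0 X) : F X := app (fmap F _ _ f) u.
have val_lin X : linear (@val X).
  by move=> c f g; rewrite /val linearP app_linearl.
have val_inj X : injective (@val X).
  move=> f g fg; apply: faithful_F; apply: app_ext => z.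
  by rewrite -(coK z) !app_act -!/(val _ _) fg.
have val_surj X (x : F X) : exists f : mor G0 X, val X f = x.
  have [||h hE] := @build_hom _ _ (F G0) (F X) (fun z => mact (F X) (co z) x).
  - move=> c z w; rewrite /co app_linear coeff_lin linearP.
    by rewrite add_lfunE scale_lfunE.
  - by move=> a z; rewrite coM actM comp_lfunE.
  have [f fE] := full_F h; exists f.
  by rewrite /val fE hE co1 act1 id_lfunE.
have val_comp X Y (g : mor X Y) f : val Y (g ∘ f) = app (fmap F _ _ g) (val X f).
  by rewrite /val fmapM app_comp.
have /choice[mul mulE] (a : A) : exists b, val G0 b = mact (F G0) a u.
  exact: val_surj.
have val_mul X (f : mor G0 X) a : val X (f ∘ mul a) = mact (F X) a (val X f).
  by rewrite val_comp mulE app_act.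
exists G0; split; last split; last split.
- move=> X Y e f epi_e; have [x xE] := epi_surjective (val Y f) epi_e.
  have [g gE] := val_surj X x.
  by exists g; apply: val_inj; rewrite val_comp gE xE.
- move=> X Y f g fg; apply: faithful_F; apply: app_ext => x.
  have [z <-] := val_surj X x.
  by rewrite -!val_comp fg.
- move=> X Y phi phi_lin phi_eq; have /choice[pt ptE] := val_surj X.
  have ptK f : pt (val X f) = f by apply: val_inj; rewrite ptE.
  have [||h hE] := @build_hom _ _ (F X) (F Y) (fun x => val Y (phi (pt x))).
  - move=> c x y; rewrite -val_lin -phi_lin; congr (val Y (phi _)).
    by apply: val_inj; rewrite val_lin !ptE.
  - move=> a x; rewrite -val_mul -phi_eq; congr (val Y (phi _)).
    by apply: val_inj; rewrite val_mul !ptE.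
  have [h' h'E] := full_F h; exists h' => x; apply: val_inj.
  by rewrite val_comp h'E hE ptK.
move=> W act act_lin act_linr act_id act_comp.
have mul_lin : linear mul.
  move=> c a b; apply: val_inj; rewrite val_lin !mulE linearP.
  by rewrite add_lfunE scale_lfunE.
have l1 (w : W) : linear (fun a => act w (mul a)).
  by move=> c a b; rewrite mul_lin act_linr.
have a1 (w : W) : act w (mul 1) = w.
  rewrite (_ : mul 1 = idm G0) //; apply: val_inj.
  by rewrite mulE act1 id_lfunE /val fmap1 app_id.
(* [mul] reverses products, so a right action of [End(G0)] becomes a left action of [A]. *)
have aM a b (w : W) : act w (mul (a * b)) = act (act w (mul b)) (mul a).
  rewrite -act_comp; congr (act w _); apply: val_inj.
  by rewrite val_mul !mulE actM comp_lfunE.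
pose M : modcat A := build_mod l1 (fun a => act_lin (mul a)) a1 aM.
have /choice[th thE] (w : W) : exists f : mor G0 (G M), val _ f = app (epsV M) (w : M).
  exact: val_surj.
exists (G M), th; split.
- move=> c w w'; apply: val_inj; rewrite val_lin !thE.
  exact: (app_linear (epsV M)).
- exists (fun f => app (eps M) (val _ f) : W) => [w|f].
    by rewrite thE -app_comp epsK app_id.
  by apply: val_inj; rewrite thE -app_comp epsVK app_id.
move=> w b; apply: (@val_inj).
have -> : b = mul (co (val _ b)) by apply: val_inj; rewrite mulE coK.
by rewrite val_mul !thE -app_act build_modE.
Qed.

End Transfer.

Section FiniteAbelian.
Variables (k : fieldType) (C : klincat k).
Hypothesis finC : finite_abelian C.

Lemma finite_abelian_powers n (M : C) : exists S i q, @biproduct_power k C n M S i q.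
Proof.
have [A [F [G [eta [eps [eta_iso eps_iso eta_nat eps_nat]]]]]] := finC.
exact: (powers eta_iso eps_iso eta_nat eps_nat).
Qed.

Lemma finite_abelian_kernels (X Y : C) (u : mor X Y) :
  exists S (i : mor S X), mono i /\ u ∘ i = 0 /\
    forall Z (f : mor Z X), u ∘ f = 0 -> exists g, f = i ∘ g.
Proof.
have [A [F [G [eta [eps [eta_iso eps_iso eta_nat eps_nat]]]]]] := finC.
exact: (kernels eta_iso eps_iso eta_nat eps_nat).
Qed.

Lemma finite_abelian_generator : exists G0 : C,
  projective G0 /\ separating G0 /\ dense G0 /\ realizing G0.
Proof.
have [A [F [G [eta [eps [eta_iso eps_iso eta_nat eps_nat]]]]]] := finC.
exact: (generator eta_iso eps_iso eta_nat eps_nat).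
Qed.

End FiniteAbelian.

(** * Eigenvectors and perfect pairings *)

Section LinearAlgebra.
Import VectorInternalTheory.

Lemma eigenvector_exists (k : closedFieldType) (V : vectType k) (T : 'End(V)) (v : V) :
  v != 0 -> exists c (x : V), x != 0 /\ T x = c *: x.
Proof.
move=> v0; pose M := lin1_mx (v2r \o T \o r2v).
(* The nonzero [v] forces positive dimension, so the characteristic polynomial is not constant and
   has a root in the closed field. *)
have [c] : exists c, root (char_poly M) c.
  apply/closed_rootP; rewrite size_char_poly eqSS.
  apply: contra v0 => /eqP d0; rewrite -(v2rK v) -(linear0 r2v); apply/eqP.
  by congr r2v; apply/rowP => i; case: i => i lt_i; exfalso; rewrite d0 in lt_i.
rewrite -eigenvalue_root_char => /eigenvalueP[x Mx x0].
exists c, (r2v x); split.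
  by apply: contra x0 => /eqP rx; rewrite -(r2vK x) rx linear0.
have := Mx; rewrite mul_rV_lin1 /= => /(congr1 r2v).
by rewrite v2rK linearZ.
Qed.

(** Nondegeneracy on each side gives an injection of [V] into the dual of [W] and one of [W] into
    the dual of [V]; comparing dimensions makes the first surjective. *)
Lemma perfect_pairing (k : fieldType) (V W : vectType k) (B : 'Hom(V, dualv W)) :
  (forall v, v <> 0 -> exists w, (B v : dualv W) w <> 0) ->
  (forall w, w <> 0 -> exists v, (B v : dualv W) w <> 0) -> bijective B.
Proof.
move=> ndl ndr.
have dim_dual (U : vectType k) : \dim {: dualv U} = \dim {: U}.
  rewrite !dimvf; exact: muln1.
have ker0 (U U' : vectType k) (f : 'Hom(U, U')) :
    (forall u, u <> 0 -> f u <> 0) -> lker f = 0%VS.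
  move=> f0; apply/eqP; rewrite -subv0; apply/subvP => u.
  rewrite memv_ker memv0 => /eqP fu; apply/eqP; apply: contrapT => u0.
  exact: f0 u u0 fu.
have lB w : linear (fun v => (B v : dualv W) w : k^o).
  by move=> c v v'; rewrite linearP add_lfunE scale_lfunE.
have lB' : linear (fun w => lin_of (lB w) : dualv V).
  move=> c w w'; apply/lfunP => v; rewrite add_lfunE scale_lfunE !lin_ofE.
  exact: linearP.
have kB : lker B = 0%VS.
  by apply: ker0 => v /ndl[w Bw] B0; apply: Bw; rewrite B0 zero_lfunE.
have kB' : lker (lin_of lB') = 0%VS.
  apply: ker0 => w /ndr[v Bv] B0; apply: Bv.
  by have := congr1 (fun f : dualv V => f v) B0; rewrite /= zero_lfunE !lin_ofE.
have fullB : limg B = fullv.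
  apply/eqP; rewrite eqEdim subvf /= dim_dual.
  have := limg_ker_dim B fullv; rewrite kB capv0 dimv0 add0n => ->.
  have := limg_ker_dim (lin_of lB') fullv; rewrite kB' capv0 dimv0 add0n => <-.
  by rewrite -dim_dual dimvS // subvf.
exists (B^-1)%VF; first by apply: lker0_lfunK; rewrite kB.
by move=> x; apply: limg_lfunVK; rewrite fullB memvf.
Qed.

End LinearAlgebra.

(** * Copowers and dual bases of projectives *)

Section Copowers.
Variables (k : fieldType) (C : klincat k).
Hypothesis powersC : forall n (M : C), exists S i q, @biproduct_power k C n M S i q.

(** The copower is the power of [M] indexed by a basis of [V], with unit [cu] sending the basis
    vectors to the injections. *)
Lemma copower_exists (V : vectType k) (M : C) : exists c : copower V M, True.
Proof.
have [S [i [q [qi iq]]]] := powersC (\dim {:V}) M.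
pose b := vbasis {:V}.
have cu_lin : linear (fun v => \sum_a coord b a v *: i a).
  move=> c v w; rewrite scaler_sumr -big_split; apply: eq_bigr => a _ /=.
  by rewrite linearP scalerDl scalerA.
pose cu : 'Hom(V, mor M S) := lin_of cu_lin.
have cub (a : 'I_(\dim {:V})) : cu b`_a = i a.
  rewrite lin_ofE (bigD1 a) //= big1 => [|a' /negPf aa'].
    by rewrite coord_free ?(basis_free (vbasisP _)) // eqxx scale1r addr0.
  by rewrite coord_free ?(basis_free (vbasisP _)) // eq_sym aa' scale0r.
have curry_lin N : linear (fun f : mor S N => (postcomp M f \o cu)%VF).
  move=> c f g; apply/lfunP => v; rewrite add_lfunE scale_lfunE !comp_lfunE.
  rewrite !postcompE; exact: comp_linl.
pose curry N : 'Hom(mor S N, 'Hom(V, mor M N)) := lin_of (curry_lin N).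
have curryE N f v : curry N f v = f ∘ cu v.
  by rewrite lin_ofE comp_lfunE postcompE.
pose uncurry N (phi : 'Hom(V, mor M N)) : mor S N :=
  \sum_(a < \dim {:V}) (phi b`_a ∘ q a).
have curryK N : cancel (curry N) (@uncurry N).
  move=> f; rewrite -[RHS]compm1 -iq compm_sumr; apply: eq_bigr => a _.
  by rewrite curryE cub Defs.compA.
have uncurryK N : cancel (@uncurry N) (curry N).
  move=> phi; apply/lfunP => v; rewrite curryE [in RHS](coord_vbasis (memvf v)).
  rewrite linear_sum lin_ofE compm_sumr; apply: eq_bigr => a _ /=.
  rewrite linearZ /= compmZr; congr (_ *: _).
  rewrite compm_suml (bigD1 a) //= big1 => [|a' /negPf aa'].
    by rewrite -Defs.compA qi eqxx compm1 addr0.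
  by rewrite -Defs.compA qi aa' compm0.
have curry_nat N N' (g : mor N N') (f : mor S N) :
    curry N' (g ∘ f) = (postcomp M g \o curry N f)%VF.
  by apply/lfunP => v; rewrite comp_lfunE !curryE postcompE Defs.compA.
by exists (Copower curryK uncurryK curry_nat).
Qed.

(** A basis of [Hom(G0, P)] assembles into a map from a power of [G0] to [P]. It is epi because [G0]
    separates, hence split. *)
Lemma projective_dual_basis (G0 P : C) : separating G0 -> projective P ->
  exists n (e : 'I_n -> mor G0 P) (s : 'I_n -> mor P G0), \sum_a (e a ∘ s a) = idm P.
Proof.
move=> sepG0 projP; pose V := mor G0 P; pose b := vbasis {:V}.
have [S [i [q [qi iq]]]] := powersC (\dim {:V}) G0.
pose e : mor S P := \sum_(a < \dim {:V}) (b`_a ∘ q a).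
have eiE (a : 'I_(\dim {:V})) : e ∘ i a = b`_a.
  rewrite compm_suml (bigD1 a) //= big1 => [|a' /negPf aa'].
    by rewrite -Defs.compA qi eqxx compm1 addr0.
  by rewrite -Defs.compA qi aa' compm0.
have epi_e : epi e.
  move=> Z g h gh; apply: sepG0 => x; rewrite (coord_vbasis (memvf x)).
  rewrite !compm_sumr; apply: eq_bigr => a _.
  by rewrite -eiE !compmZr !Defs.compA gh.
have [s es] := projP _ _ e (idm P) epi_e.
exists _, (fun a : 'I_(\dim {:V}) => b`_a), (fun a => q a ∘ s); rewrite -es compm_suml.
by apply: eq_bigr => a _; rewrite Defs.compA.
Qed.

End Copowers.

(** * The Nakayama functor *)

Section Duals.
Variables (k : fieldType) (C : klincat k).
Implicit Types X Y Z M : C.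

Lemma dual_postcomp_comp M X Y Z (g : mor Y Z) (f : mor X Y) (xi : dualv (mor M Z)) :
  dual_postcomp M (g ∘ f) xi = dual_postcomp M f (dual_postcomp M g xi).
Proof. by apply/lfunP => x; rewrite !dual_postcompE Defs.compA. Qed.

Lemma dual_postcomp_id M X (xi : dualv (mor M X)) : dual_postcomp M (idm X) xi = xi.
Proof. by apply/lfunP => x; rewrite dual_postcompE comp1m. Qed.

Lemma dual_postcomp_linear_in_mor M X Y (xi : dualv (mor M Y)) :
  linear (fun f : mor X Y => dual_postcomp M f xi).
Proof.
move=> c f g; apply/lfunP => x; rewrite add_lfunE scale_lfunE !dual_postcompE.
by rewrite comp_linl linearP.
Qed.

End Duals.

Section NakayamaFunctor.
Variables (k : fieldType) (C : klincat k) (G0 : C).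
Hypothesis sepG0 : separating G0.
Hypothesis denseG0 : dense G0.
Hypothesis powersC : forall n (M : C), exists S i q, @biproduct_power k C n M S i q.
Implicit Types X Y Z M N : C.

(* By [separating] and [dense] such a [th] amounts to an isomorphism
   Hom(M, G0)^* = Hom(G0, N) of right End(G0)-modules, which pins down N as the
   value of the Nakayama functor at M. *)
Definition nakayama_iso M N (th : dualv (mor M G0) -> mor G0 N) : Prop :=
  [/\ linear th, bijective th &
    forall xi (b : mor G0 G0), th (dual_postcomp M b xi) = th xi ∘ b].

(** For fixed [xi], sending [x] to [th (dual_postcomp M x xi)] commutes with precomposition by
    [End(G0)], so density realizes it by a morphism. The family [J] is the universal cowedge before
    passing to copowers. *)
Lemma nakayama_iso_extension M N (th : dualv (mor M G0) -> mor G0 N) :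
    nakayama_iso th ->
  exists J : forall X, 'Hom(dualv (mor M X), mor X N),
    [/\ forall X xi (x : mor G0 X), J X xi ∘ x = th (dual_postcomp M x xi),
        forall X Y (f : mor X Y) xi, J X (dual_postcomp M f xi) = J Y xi ∘ f
      & forall xi, J G0 xi = th xi].
Proof.
move=> [th_lin _ th_eq].
have J_ex X : exists J : 'Hom(dualv (mor M X), mor X N),
    forall xi (x : mor G0 X), J xi ∘ x = th (dual_postcomp M x xi).
  have /choice[J0 J0E] (xi : dualv (mor M X)) : exists h : mor X N,
      forall x : mor G0 X, h ∘ x = th (dual_postcomp M x xi).
    apply: denseG0 => [c x y|x b]; last by rewrite dual_postcomp_comp th_eq.
    by rewrite dual_postcomp_linear_in_mor th_lin.
  have J0_lin : linear J0.
    move=> c xi xi'; apply: sepG0 => x.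
    by rewrite comp_linl !J0E linearP th_lin.
  by exists (lin_of J0_lin) => xi x; rewrite lin_ofE J0E.
exists (fun X => projT1 (cid (J_ex X))).
have JE X := projT2 (cid (J_ex X)); split=> // [X Y f xi|xi].
  by apply: sepG0 => x; rewrite JE -Defs.compA JE dual_postcomp_comp.
by rewrite -[LHS]compm1 JE dual_postcomp_id.
Qed.

Lemma uncurry_cpunit V M (c : copower V M) N (phi : 'Hom(V, mor M N)) v :
  Defs.uncurry c phi ∘ cpunit c v = phi v.
Proof.
have := Defs.curryE (Defs.uncurry c phi); rewrite Defs.uncurryK => /lfunP/(_ v) ->.
by rewrite comp_lfunE postcompE.
Qed.

(** Tested on the copower units, a cowedge is a family of maps from [Hom(M, X)^*] to [Hom(X, E)]
    natural in [X]. *)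
Lemma cowedge_cpunit M (cp : forall X Y, copower (dualv (mor M X)) Y) E
    (j : forall X, mor (nakayama_integrand cp X X) E) :
  cowedge j <-> forall X Y (f : mor X Y) xi,
    j X ∘ cpunit (cp X X) (dual_postcomp M f xi) = j Y ∘ cpunit (cp Y Y) xi ∘ f.
Proof.
split=> [jw X Y f xi|jn X Y f].
  have := congr1 (fun h => h ∘ cpunit (cp Y X) xi) (jw X Y f).
  rewrite /= -!Defs.compA !cpmapE compm1 dual_postcomp_id => ->.
  by rewrite Defs.compA.
apply: copower_ext => xi; rewrite /= -!Defs.compA !cpmapE compm1.
by rewrite dual_postcomp_id jn Defs.compA.
Qed.

Lemma nakayama_iso_coend M N (th : dualv (mor M G0) -> mor G0 N)
    (cp : forall X Y, copower (dualv (mor M X)) Y) :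
  nakayama_iso th -> is_coend (nakayama_integrand cp) N.
Proof.
move=> thP; have [th_lin [thV thK thVK] th_eq] := thP.
have [J [JE J_nat JG]] := nakayama_iso_extension thP.
pose i X : mor (nakayama_integrand cp X X) N := Defs.uncurry (cp X X) (J X).
have iE X xi : i X ∘ cpunit (cp X X) xi = J X xi by rewrite /i uncurry_cpunit.
exists i; first by apply/cowedge_cpunit => X Y f xi; rewrite !iE J_nat.
move=> E j /cowedge_cpunit j_nat.
(* The value at [f] is forced: on the copower unit, the component of the cowedge at [G0] is [th], so
   a mediating map must send [th xi] to the value of [j G0] at [xi]. *)
pose phi (f : mor G0 N) := j G0 ∘ cpunit (cp G0 G0) (thV f).
have [||h hE] := denseG0 (phi := phi).
- move=> c f g; rewrite /phi (_ : thV (c *: f + g) = c *: thV f + thV g).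
    by rewrite linearP comp_linr.
  by apply: (can_inj thK); rewrite th_lin !thVK.
- move=> f b; rewrite /phi -j_nat; congr (_ ∘ cpunit _ _).
  by apply: (can_inj thK); rewrite th_eq !thVK.
exists h; split=> [X|h' h'E].
  apply: copower_ext => xi; rewrite -Defs.compA iE; apply: sepG0 => x.
  by rewrite -Defs.compA JE hE /phi thK j_nat.
by apply: sepG0 => f; rewrite hE /phi -h'E -Defs.compA iE JG thVK.
Qed.

Lemma coend_unique (B : bifunctor C) N N' : is_coend B N -> is_coend B N' ->
  isomorphic N N'.
Proof.
move=> [i iw iU] [i' iw' iU'].
have [h [hE _]] := iU _ _ iw'; have [g [gE _]] := iU' _ _ iw.
exists h, g; split.
  have [u [_ uU]] := iU _ _ iw; rewrite -(uU (idm N)) => [|X]; last exact: comp1m.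
  by apply/esym/uU => X; rewrite -Defs.compA hE gE.
have [u [_ uU]] := iU' _ _ iw'; rewrite -(uU (idm N')) => [|X]; last exact: comp1m.
by apply/esym/uU => X; rewrite -Defs.compA gE hE.
Qed.

Lemma copower_family M : exists cp : forall X Y, copower (dualv (mor M X)) Y, True.
Proof.
by exists (fun X Y => projT1 (cid (copower_exists powersC (dualv (mor M X)) Y))).
Qed.

Lemma nakayama_iso_exists M : realizing G0 ->
  exists N (th : dualv (mor M G0) -> mor G0 N), nakayama_iso th.
Proof.
move=> /(_ (dualv (mor M G0)) (fun xi b => dual_postcomp M b xi)) [].
- by move=> b c xi xi'; rewrite linearP.
- by move=> xi; apply: dual_postcomp_linear_in_mor.
- exact: dual_postcomp_id.
- by move=> xi b b'; rewrite dual_postcomp_comp.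
by move=> N [th [th_lin th_bij th_eq]]; exists N, th.
Qed.

Lemma nakayama_iso_transport M N N' (th : dualv (mor M G0) -> mor G0 N) :
    nakayama_iso th -> isomorphic N N' ->
  exists th' : dualv (mor M G0) -> mor G0 N', nakayama_iso th'.
Proof.
move=> [th_lin [thV thK thVK] th_eq] [h [g [gh hg]]].
exists (fun xi => h ∘ th xi); split=> [c xi xi'||xi b].
- by rewrite th_lin comp_linr.
- exists (fun f => thV (g ∘ f)) => [xi|f]; first by rewrite Defs.compA gh comp1m thK.
  by rewrite thVK Defs.compA hg comp1m.
by rewrite th_eq Defs.compA.
Qed.

(** For the direction from coends, [realizing] supplies some object with a [nakayama_iso]; it is a
    coend of the same integrand, and uniqueness of coends transports the isomorphism. *)
Lemma is_nakayamaP M N : realizing G0 ->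
  (exists2 N', is_nakayama M N' & isomorphic N' N) <->
  exists th : dualv (mor M G0) -> mor G0 N, nakayama_iso th.
Proof.
move=> realG0; split=> [[N' [cp N'P] N'N]|[th thP]]; last first.
  have [cp _] := copower_family M; exists N; last first.
    by exists (idm N), (idm N); rewrite comp1m.
  by exists cp; exact: nakayama_iso_coend thP.
have [N0 [th thP]] := nakayama_iso_exists M realG0.
have [th' thP'] := nakayama_iso_transport thP
  (coend_unique (nakayama_iso_coend cp thP) N'P).
exact: nakayama_iso_transport thP' N'N.
Qed.

(** [J] is natural and bijective at [G0], and a dual basis exhibits [P] as a direct summand of a
    power of [G0]. *)
Lemma nakayama_iso_projective M N (th : dualv (mor M G0) -> mor G0 N)
    (J : forall X, 'Hom(dualv (mor M X), mor X N)) P :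
    nakayama_iso th ->
    (forall X Y (f : mor X Y) xi, J X (dual_postcomp M f xi) = J Y xi ∘ f) ->
    (forall xi, J G0 xi = th xi) -> projective P ->
  cancel (J P) (J P)^-1%VF /\ cancel (J P)^-1%VF (J P).
Proof.
move=> [th_lin [thV thK thVK] th_eq] J_nat JG projP.
have [n [e [s es]]] := projective_dual_basis powersC sepG0 projP.
have J_inj : lker (J P) == 0%VS.
  rewrite -subv0; apply/subvP => xi; rewrite memv_ker memv0 => /eqP Jxi.
  apply/eqP/lfunP => g; rewrite zero_lfunE -[g]comp1m -es compm_suml linear_sum /=.
  apply: big1 => a _; rewrite -Defs.compA -dual_postcompE.
  suff -> : dual_postcomp M (e a) xi = 0 by rewrite zero_lfunE.
  apply: (can_inj thK); rewrite -!JG J_nat Jxi linear0.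
  exact: comp0m.
split; first exact: lker0_lfunK.
move=> f; apply: limg_lfunVK; apply/memv_imgP.
exists (\sum_a dual_postcomp M (s a) (thV (f ∘ e a))); first exact: memvf.
rewrite linear_sum -[LHS]compm1 -es compm_sumr; apply: eq_bigr => a _ /=.
by rewrite J_nat JG thVK Defs.compA.
Qed.

End NakayamaFunctor.

(** If [u ∘ f = 0], then [f] factors through the kernel of [u], a nonzero subobject of [S] and hence
    all of it; so [u = 0]. *)
Lemma simple_epi (k : fieldType) (C : klincat k) (S X : C) (f : mor X S) :
    (forall (X Y : C) (u : mor X Y), exists K (i : mor K X), mono i /\ u ∘ i = 0 /\
      forall Z (f : mor Z X), u ∘ f = 0 -> exists g, f = i ∘ g) ->
  simple_obj S -> f <> 0 -> epi f.
Proof.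
move=> kerC [_ simS] f0; apply: epi0 => Z u uf.
have [K [i [mi [ui /(_ _ _ uf) [g fE]]]]] := kerC _ _ u.
have [i0|[h [_ ih]]] := simS _ _ mi; first by case: f0; rewrite fE i0 comp0m.
by rewrite -[u]compm1 -ih Defs.compA ui comp0m.
Qed.

(** * Modified traces and unimodularity *)

Section Main.
Variables (k : closedFieldType) (C : finTensorCat k) (p : pivotal C).

Lemma epi_to_unit (X : C) (f : mor X (tunit C)) : f <> 0 -> epi f.
Proof.
apply: simple_epi (ftc_simple_one C).
exact: finite_abelian_kernels (ftc_finite C).
Qed.

(** Otherwise [G0] could not separate the identity of the unit from [0]. *)
Lemma separating_to_unit (G0 : C) : separating G0 ->
  exists x : mor G0 (tunit C), x != 0.
Proof.
move=> sepG0; apply: contrapT => x0; case: (ftc_simple_one C) => + _; apply.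
apply: sepG0 => x; rewrite comp1m comp0m; apply/eqP; apply: contrapT => xn.
by apply: x0; exists x; exact/negP.
Qed.

Definition unit_pairing (t : trace_family C) (P : C) (hP : projective P)
    (f : mor P (tunit C)) : dualv (mor (tunit C) P) :=
  (t P hP \o precomp P f)%VF.

Lemma unit_pairingE t P hP f g : unit_pairing t (P := P) hP f g = t P hP (g ∘ f).
Proof. by rewrite comp_lfunE precompE. Qed.

Lemma unit_pairing_linear t P hP : linear (unit_pairing t (P := P) hP).
Proof.
move=> c f g; apply/lfunP => x.
by rewrite add_lfunE scale_lfunE !unit_pairingE comp_linr linearP.
Qed.

Lemma unit_pairing_bijective t P hP : right_modified_trace p t -> nonzero_trace t ->
  bijective (lin_of (unit_pairing_linear t (P := P) hP)).
Proof.
move=> rmt [Q [hQ [q tq]]]; apply: perfect_pairing => [f|g] /=.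
  move=> /(trace_nondegenerate_l epi_to_unit rmt tq hP)[g tgf].
  by exists g; rewrite lin_ofE unit_pairingE.
move=> /(trace_nondegenerate_r epi_to_unit rmt tq hP)[f tgf].
by exists f; rewrite lin_ofE unit_pairingE.
Qed.

Lemma modified_trace_unimodular :
  (exists t : trace_family C, right_modified_trace p t /\ nonzero_trace t) ->
  unimodular C.
Proof.
move=> [t [rmt t0]].
have [G0 [projG0 [sepG0 [denseG0 realG0]]]] := finite_abelian_generator (ftc_finite C).
have powersC := @finite_abelian_powers _ _ (ftc_finite C).
apply/(is_nakayamaP sepG0 denseG0 powersC (tunit C) (tunit C) realG0).
pose B := lin_of (unit_pairing_linear t projG0).
have BE f g : (B f : dualv _) g = t G0 projG0 (g ∘ f) by rewrite lin_ofE unit_pairingE.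
have [th thK Kth] : bijective B by exact: unit_pairing_bijective.
have B_inj := can_inj thK.
(* [th] inverts the pairing at [G0]; its compatibility with [End(G0)], checked after [B], is
   cyclicity of the trace. *)
exists th; split=> [c xi xi'||xi b].
- by apply: (can_inj thK); rewrite linearP /= !Kth.
- by exists B.
apply: B_inj; rewrite Kth; apply/lfunP => g.
rewrite dual_postcompE -{1}(Kth xi) !BE.
by rewrite Defs.compA (rmt.1 _ _ projG0 projG0) -!Defs.compA.
Qed.

Lemma unimodular_modified_trace : unimodular C ->
  exists t : trace_family C, right_modified_trace p t /\ nonzero_trace t.
Proof.
have [G0 [projG0 [sepG0 [denseG0 realG0]]]] := finite_abelian_generator (ftc_finite C).
have powersC := @finite_abelian_powers _ _ (ftc_finite C).
move/(is_nakayamaP sepG0 denseG0 powersC (tunit C) (tunit C) realG0) => [th thP].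
have [J [_ J_nat JG]] := nakayama_iso_extension sepG0 denseG0 thP.
have J_bij P (hP : projective P) :=
  nakayama_iso_projective sepG0 powersC thP J_nat JG hP.
(* [J] is invertible on projectives, and naturality of [J] becomes that required of [lam]. *)
pose lam P (hP : projective P) := ((J P)^-1)%VF.
exists (trace_of p lam); split.
  apply: trace_of_modified => P Q hP hQ h f g.
  rewrite -dual_postcompE; congr (fun_of_lfun _ g).
  apply: (can_inj (J_bij P hP).1).
  by rewrite J_nat !(J_bij _ _).2.
apply: trace_of_nonzero => [||Q hQ f lf].
- exact: projG0.
- move=> id0; have [x /eqP x0] := separating_to_unit sepG0.
  by apply: x0; rewrite -[x]compm1 id0 compm0.
by rewrite -((J_bij Q hQ).2 f) lf linear0.
Qed.

Lemma modified_trace_unique (t t' : trace_family C) :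
    right_modified_trace p t -> nonzero_trace t -> right_modified_trace p t' ->
  exists c : k, forall (P : C) (hP : projective P) (f : mor P P),
    t' P hP f = c * t P hP f.
Proof.
move=> rmt t0 rmt'.
have [G0 [projG0 [sepG0 _]]] := finite_abelian_generator (ftc_finite C).
have [x x0] := separating_to_unit sepG0.
have BE s f g : (lin_of (unit_pairing_linear s projG0) f : dualv _) g =
    s G0 projG0 (g ∘ f) by rewrite lin_ofE unit_pairingE.
pose B := lin_of (unit_pairing_linear t projG0).
pose B' := lin_of (unit_pairing_linear t' projG0).
have [B1 B1K KB1] : bijective B by exact: unit_pairing_bijective.
have B1_lin : linear B1.
  by move=> c xi xi'; apply: (can_inj B1K); rewrite linearP /= !KB1.
(* [B1] inverts the pairing of [t], so an eigenvector of [B1] after [B'] satisfies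
   [B' f = c *: B f]. *)
have [c [f [f0 fE]]] := eigenvector_exists (lin_of B1_lin \o B')%VF x0.
exists c => P hP q.
have {fE} fE g : t' G0 projG0 (g ∘ f) = c * t G0 projG0 (g ∘ f).
  have : B' f = c *: B f.
    rewrite comp_lfunE lin_ofE in fE.
    by rewrite -(KB1 (B' f)) fE linearZ.
  move/(congr1 (fun xi : dualv (mor (tunit C) G0) => xi g)).
  by rewrite scale_lfunE !BE.
(* [s] is again a modified trace, and its pairing kills the nonzero [f]; by nondegeneracy it takes
   no nonzero value. *)
pose s : trace_family C := fun P hP => (t' P hP - c *: t P hP).
have sE Q hQ r : s Q hQ r = t' Q hQ r - c * t Q hQ r.
  by rewrite add_lfunE opp_lfunE scale_lfunE.
have rms : right_modified_trace p s.
  split=> [P1 Q hP1 hQ g h|P1 X hP1 hPX g]; rewrite !sE.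
    by rewrite (rmt.1 _ _ _ hQ) (rmt'.1 _ _ _ hQ).
  by rewrite (rmt.2 _ _ _ hPX) (rmt'.2 _ _ _ hPX).
apply: contrapT => tq.
have sq : s P hP q <> 0.
  by rewrite sE => /eqP; rewrite subr_eq0 => /eqP.
have [g] := trace_nondegenerate_l epi_to_unit rms sq projG0 (elimN eqP f0).
by rewrite sE fE subrr.
Qed.

End Main.

Theorem theorem1p2 (k : closedFieldType) (C : finTensorCat k) (p : pivotal C) :
  ((exists t : trace_family C, right_modified_trace p t /\ nonzero_trace t)
     <-> unimodular C) /\
  (forall t t' : trace_family C,
     right_modified_trace p t -> nonzero_trace t ->
     right_modified_trace p t' -> nonzero_trace t' ->
     exists c : k, forall (P : C) (hP : projective P) (f : mor P P),
       t' P hP f = c * t P hP f).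
Proof.
split; last by move=> t t' rmt t0 rmt' _; exact: modified_trace_unique rmt t0 rmt'.
split; [exact: modified_trace_unimodular|exact: unimodular_modified_trace].
Qed.
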